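(* Let $\phi:\mathbb{R}^d\to\mathbb{R}$ be continuous and symmetric ($\phi(-x)=\phi(x)$ for all $x$), with $|\phi|_\infty:=\sup_{x\in[0,1]^d}\sum_{k\in\mathbb{Z}^d}|\phi(x-k)|<\infty$ and with cardinal symbol satisfying $\sigma_\phi(\zeta)>0$ for all $\zeta\in T^d$. Let the half-space lattice $H$ be either $\mathbb{Z}^{d-1}\times\mathbb{Z}_+$ or $\mathbb{Z}^d_{\preceq,+}$. Let $T_\phi=[\phi(j-k)]_{j,k\in H}$ be the semi-infinite Toeplitz operator, $(T_\phi c)_j=\sum_{k\in H}\phi(j-k)c_k$, $j\in H$, and let $G=[G_{kj}]_{k,j\in H}$ be the matrix with $G_{kj}=\gamma_{k-j}$, where $\{\gamma_k\}_{k\in H}$ are the Fourier coefficients of the Wiener-Hopf factor $\omega_+$ and $\gamma_k:=0$ for $k\in\mathbb{Z}^d\setminus H$. Then the linear operator $T_\phi$ is bounded and invertible on $\ell_p(H)$ for all $p\in[1,\infty]$. Further, the inverse operator is $T_\phi^{-1}=[a_{k,j}]_{k,j\in H}$, where $\{a_{k,j}\}_{k\in H}$ are the Fourier coefficients of the semi-cardinal symbol $\omega_j$, and it admits the factorization $$T_\phi^{-1}=GG^T,$$ where $G$ is also bounded and invertible on $\ell_p(H)$ and $G^T$ denotes its transpose.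
   Context: Notation: write $x=(x',x_d)$ with $x'\in\mathbb{R}^{d-1}$ for $d$-dimensional vectors. $T^d=\{\zeta\in\mathbb{C}^d:|\zeta_1|=\dots=|\zeta_d|=1\}$, $\zeta^k=\zeta_1^{k_1}\cdots\zeta_d^{k_d}$ for $k\in\mathbb{Z}^d$, $\zeta^{-1}=(\zeta_1^{-1},\dots,\zeta_d^{-1})$. $W=W(T^d)$ is the Wiener algebra of continuous functions $u$ on $T^d$ with absolutely summable Fourier coefficients $\{\widehat u_k\}_{k\in\mathbb{Z}^d}$, $\|u\|_W=\sum_k|\widehat u_k|$. $\mathbb{Z}_+=\{0,1,2,\dots\}$. Half-space lattice: a set $H\subset\mathbb{Z}^d$ that is either $H=\mathbb{Z}^{d-1}\times\mathbb{Z}_+$, or $H=\mathbb{Z}^d_{\preceq,+}:=\{j\in\mathbb{Z}^d:0\preceq j\}$, where $\preceq$ is a linear (total) order on $\mathbb{Z}^d$ compatible with addition ($j\preceq k$ implies $j+l\preceq k+l$). Cardinal symbol: $\sigma_\phi(\zeta)=\sum_{k\in\mathbb{Z}^d}\phi(k)\zeta^k$, $\zeta\in T^d$. Under the stated assumptions on $\phi$, $\omega:=1/\sigma_\phi\in W$ and $\log\omega\in W$; write $\log\omega(\zeta)=\sum_{k\in\mathbb{Z}^d}\lambda_k\zeta^k$. Wiener-Hopf factor: if $H=\mathbb{Z}^{d-1}\times\mathbb{Z}_+$, let $\Lambda_+(\zeta)=\frac12\sum_{k'\in\mathbb{Z}^{d-1}}\lambda_{(k',0)}(\zeta')^{k'}+\sum_{k_d=1}^\infty\sum_{k'\in\mathbb{Z}^{d-1}}\lambda_k\zeta^k$;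 if $H=\mathbb{Z}^d_{\preceq,+}$, let $\Lambda_+(\zeta)=\frac12\lambda_0+\sum_{k\succ0}\lambda_k\zeta^k$. Set $\omega_+=\exp(\Lambda_+)$. Then $\omega(\zeta)=\omega_+(\zeta)\omega_+(\zeta^{-1})$, $\omega_+\in W$, and its Fourier coefficients are supported on $H$: $\omega_+(\zeta)=\sum_{k\in H}\gamma_k\zeta^k$. Semi-cardinal symbols: let $P_+\{\sum_{k\in\mathbb{Z}^d}\widehat\psi_k\zeta^k\}=\sum_{k\in H}\widehat\psi_k\zeta^k$ for $\psi\in W$. For $j\in H$, $\omega_j(\zeta):=\omega_+(\zeta)\,P_+\{\zeta^j\omega_+(\zeta^{-1})\}$, which lies in $W$ with Fourier coefficients supported on $H$: $\omega_j(\zeta)=\sum_{k\in H}a_{k,j}\zeta^k$. *)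

(* Defs.v *)
From HB Require Import structures.
From mathcomp Require Import all_boot all_order all_algebra.
From mathcomp Require Import complex.
From mathcomp Require Import all_classical all_reals all_analysis.
Set Implicit Arguments.
Unset Strict Implicit.
Unset Printing Implicit Defensive.
Import Order.TTheory GRing.Theory Num.Theory.
Import numFieldNormedType.Exports.
Local Open Scope classical_set_scope.
Local Open Scope complex_scope.
Local Open Scope ring_scope.

Notation lattice d := 'rV[int]_d.

Record lattice_order (d : nat) := LatticeOrder {
  lo_rel :> rel (lattice d);
  lo_anti : antisymmetric lo_rel;
  lo_trans : transitive lo_rel;
  lo_total : total lo_rel;
  lo_add : forall j k l : lattice d, lo_rel j k -> lo_rel (j + l) (k + l)
}.

(* The dimension is d = n.+1, so that there is a last coordinate. *)
Inductive half_lattice (n : nat) :=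
  | CoordHalf
  | OrderHalf of lattice_order n.+1.

Definition in_half n (H : half_lattice n) : pred (lattice n.+1) :=
  match H with
  | CoordHalf => fun k => 0 <= k 0 ord_max
  | OrderHalf le => fun k => le 0 k
  end.

Notation half_index H := {k | in_half H k}.

Section Sums.
Variables (R : realType) (I : choiceType).

(* Meaningful (unordered, absolutely convergent sums) only for summable
   families. *)
Definition rsum (D : set I) (f : I -> R) : R :=
  fine (\esum_(i in D) (EFin \o f)^\+%E i - \esum_(i in D) (EFin \o f)^\-%E i)%E.

Definition csum (D : set I) (f : I -> R[i]) : R[i] :=
  Complex (rsum D (fun i => complex.Re (f i)))
          (rsum D (fun i => complex.Im (f i))).

Definition csummable (D : set I) (f : I -> R[i]) : Prop :=
  summable D (fun i => (Normc.normc (f i))%:E).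

End Sums.

Section Torus.
Variable R : realType.

Definition torus d (z : 'rV[R[i]]_d) : Prop := forall i, `|z 0 i| = 1.

Definition monom d (k : lattice d) (z : 'rV[R[i]]_d) : R[i] :=
  \prod_(i < d) z 0 i ^ k 0 i.

Definition torus_inv d (z : 'rV[R[i]]_d) : 'rV[R[i]]_d :=
  map_mx (fun w => w^-1) z.

Definition cexp (z : R[i]) : R[i] :=
  let: Complex x y := z in Complex (expR x * cos y) (expR x * sin y).

Definition torus_point d (t : 'rV[R]_d) : 'rV[R[i]]_d :=
  map_mx (fun s => cexp (Complex 0 (2 * pi * s))) t.

(* Iterated integral over [0, 1]^d; the functions it is applied to are
   continuous. *)
Fixpoint cube_integral (d : nat) : ('rV[R]_d -> R) -> R :=
  match d with
  | 0 => fun f => f 0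
  | d'.+1 => fun f =>
      \int[lebesgue_measure]_(s in `[0%R, 1%R])
        cube_integral
          (fun t : 'rV_d' => f (row_mx (const_mx s : 'rV_1) t))
  end.

Definition fourier d (u : 'rV[R[i]]_d -> R[i]) (k : lattice d) : R[i] :=
  let v t := u (torus_point t) * monom (- k) (torus_point t) in
  Complex (cube_integral (fun t => complex.Re (v t)))
          (cube_integral (fun t => complex.Im (v t))).

End Torus.

Section Symbols.
Variables (R : realType) (n : nat).
Let d := n.+1.
Variables (phi : 'rV[R]_d -> R) (H : half_lattice n).

Definition lattice_pt (k : lattice d) : 'rV[R]_d := map_mx intr k.

Definition amalgam_norm : \bar R :=
  ereal_sup [set (\esum_(k in [set: lattice d])
                    `|phi (x - lattice_pt k)|%:E)%E
            | x in [set x : 'rV[R]_d | forall i, 0 <= x 0 i <= 1]].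

Definition cardinal_symbol (z : 'rV[R[i]]_d) : R[i] :=
  csum [set: lattice d] (fun k => (phi (lattice_pt k))%:C * monom k z).

Definition omega (z : 'rV[R[i]]_d) : R[i] := (cardinal_symbol z)^-1.

(* omega is real and positive on the torus. *)
Definition log_omega (z : 'rV[R[i]]_d) : R[i] := (ln (complex.Re (omega z)))%:C.

Definition lambda : lattice d -> R[i] := fourier log_omega.

Definition Lambda_plus (z : 'rV[R[i]]_d) : R[i] :=
  match H with
  | CoordHalf =>
      2^-1 * csum [set k : lattice d | k 0 ord_max = 0]
               (fun k => lambda k * monom k z)
      + csum [set k : lattice d | 0 < k 0 ord_max]
          (fun k => lambda k * monom k z)
  | OrderHalf le =>
      2^-1 * lambda 0
      + csum [set k : lattice d | le 0 k && (k != 0)]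
          (fun k => lambda k * monom k z)
  end.

Definition omega_plus (z : 'rV[R[i]]_d) : R[i] := cexp (Lambda_plus z).

Definition gamma (k : lattice d) : R[i] :=
  if in_half H k then fourier omega_plus k else 0.

Definition P_plus (psi : 'rV[R[i]]_d -> R[i]) (z : 'rV[R[i]]_d) : R[i] :=
  csum [set k : lattice d | in_half H k]
    (fun k => fourier psi k * monom k z).

Definition semicardinal_symbol (j : lattice d) (z : 'rV[R[i]]_d) : R[i] :=
  omega_plus z * P_plus (fun w => monom j w * omega_plus (torus_inv w)) z.

Definition toeplitz (j k : half_index H) : R[i] :=
  (phi (lattice_pt (val j - val k)))%:C.

Definition G_mx (k j : half_index H) : R[i] := gamma (val k - val j).

Definition a_mx (k j : half_index H) : R[i] :=
  fourier (semicardinal_symbol (val j)) (val k).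

End Symbols.

Section Operators.
Variables (R : realType) (I : choiceType).
Implicit Types (p : \bar R) (c : I -> R[i]) (M N : I -> I -> R[i]).
Implicit Types (A B : (I -> R[i]) -> (I -> R[i])).

Definition lp_norm p c : \bar R :=
  match p with
  | r%:E => ((\esum_(k in [set: I]) (Normc.normc (c k) `^ r)%:E)
               `^ r^-1)%E
  | +oo%E => ereal_sup (range (fun k => (Normc.normc (c k))%:E))
  | -oo%E => 0%E
  end.

Definition lp p : set (I -> R[i]) := [set c | (lp_norm p c < +oo)%E].

Definition mx_op M c : I -> R[i] :=
  fun j => csum [set: I] (fun k => M j k * c k).

Definition mx_tr M : I -> I -> R[i] := fun j k => M k j.

Definition mx_prod M N : I -> I -> R[i] :=
  fun j k => csum [set: I] (fun l => M j l * N l k).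

Definition bounded_op p A : Prop :=
  [/\ forall (x : R[i]) c c', lp p c -> lp p c' ->
        A (fun k => x * c k + c' k) = (fun k => x * A c k + A c' k),
      forall c, lp p c -> lp p (A c)
    & exists C : R, forall c, lp p c ->
        (lp_norm p (A c) <= C%:E * lp_norm p c)%E].

Definition bounded_mx p M : Prop :=
  (forall c j, lp p c -> csummable [set: I] (fun k => M j k * c k)) /\
  bounded_op p (mx_op M).

Definition inverse_op p A B : Prop :=
  bounded_op p B /\ forall c, lp p c -> B (A c) = c /\ A (B c) = c.

Definition invertible_op p A : Prop := exists B, inverse_op p A B.

End Operators.

(* Main.v *)
(** Identify functions on the torus having absolutely summable Fourier coefficients
    with l1 families on the lattice; products of functions are convolutions, and
    integrating an absolutely convergent series recovers its coefficients.

    Wiener-Levy for the logarithm: scale the cardinal symbol to [M (1 - u)] with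
    [0 <= u <= q < 1] and expand [- ln (1 - u) = \sum_n u ^ n / n].  The series
    converges in l1 because the l1 norm of [u ^ n] is at most a polynomial in [n]
    times [((1 + q) / 2) ^ n], as one sees by approximating [u] by a trigonometric
    polynomial.  Halving [lambda] at the boundary of the half-lattice and
    exponentiating gives [omega_plus] with coefficients [g], and its inverse with
    coefficients [h], both supported in the half-lattice.

    Write [Tz a] for the compression [a (j - k)] to the half-lattice.  Then
    [Tz a * Tz b = Tz (a * b)] as soon as [b] is supported in the half-lattice or
    [a] in its opposite.  Hence [T = Tz (mirror h) * Tz h], [G = Tz g],
    [G^T = Tz (mirror g)], and [Tz h], [Tz (mirror h)] are the inverses of [G] and
    [G^T].  Boundedness on every l_p is Schur's test. *)
Require Import Defs.
From HB Require Import structures.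
From mathcomp Require Import all_boot all_order all_algebra.
From mathcomp Require Import complex.
From mathcomp Require Import all_classical all_reals all_analysis.
From mathcomp Require Import zify ring lra.
Import Order.TTheory GRing.Theory Num.Theory.
Import numFieldNormedType.Exports.
Local Open Scope classical_set_scope.
Local Open Scope complex_scope.
Local Open Scope ring_scope.

Set Implicit Arguments.
Unset Strict Implicit.
Unset Printing Implicit Defensive.


(** The obstacle is the logarithm. Its series in [u] converges at once for the sup norm, but the l1
    norm of [u] may exceed 1, so a termwise l1 bound fails. Spectral radius theory would give l1
    growth at the rate of the sup norm. The elementary substitute: for trigonometric polynomials the
    two norms differ at most by the number of frequencies, which is polynomial in [n] for an n-th
    power and is absorbed by a slightly larger ratio.

    Symmetry of [phi] makes [lambda] even, so the second Wiener-Hopf factor is the reflection of the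
    first and the inverse has the form [G G^T]. The order of the factors matters:
    [Tz (mirror h) * Tz h] is again Toeplitz, while [Tz g * Tz (mirror g)], which inverts it, in
    general is not.

    All inverses are first obtained as identities between matrices with bounded absolute row and
    column sums. One Schur constant then serves every l_p, including p = oo, where finitely
    supported sequences are not dense. *)

Local Notation normc := Normc.normc.

(** * Unordered sums *)

Section EsumComplements.
Variable R : realType.

(** Finite partial sums give one inequality; the other is the same inequality for [c^-1], whence the
    separate case [c = 0]. *)
Lemma esumZl (I : choiceType) (c : R) (a : I -> \bar R) : 0 <= c ->
  (forall i, 0 <= a i)%E ->
  (\esum_(i in setT) (c%:E * a i) = c%:E * \esum_(i in setT) a i)%E.
Proof.
have le_esumZ (d : R) (b : I -> \bar R) : 0 <= d -> (forall i, 0 <= b i)%E ->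
    (\esum_(i in setT) (d%:E * b i) <= d%:E * \esum_(i in setT) b i)%E.
  move=> d0 b0; apply: ge_ereal_sup => _ [X [finX XI] <-].
  rewrite -ge0_mule_fsumr// lee_wpmul2l ?lee_fin// ereal_sup_ubound//.
  by exists X.
rewrite le_eqVlt => /predU1P[<- _|c0 a0].
  by rewrite mul0e esum1// => i _; rewrite mul0e.
apply/eqP; rewrite eq_le le_esumZ ?(ltW c0)//=.
have ci0 : 0 <= c^-1 by rewrite invr_ge0 ltW.
rewrite -[leRHS]mul1e -(divff (lt0r_neq0 c0)) EFinM -muleA.
rewrite lee_wpmul2l ?lee_fin ?(ltW c0)//.
have := le_esumZ c^-1 (fun i => c%:E * a i)%E ci0
  (fun i => mule_ge0 (ltW c0 : (0%R <= c%:E)%E) (a0 i)).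
apply: le_trans; apply: le_esum => i _.
by rewrite muleA -EFinM mulVf ?lt0r_neq0// mul1e.
Qed.

Lemma esum_swap (I J : choiceType) (a : I -> J -> \bar R) :
  (forall i j, 0 <= a i j)%E ->
  (\esum_(i in setT) \esum_(j in setT) a i j =
   \esum_(j in setT) \esum_(i in setT) a i j)%E.
Proof.
move=> a0; rewrite !esum_esum//.
rewrite (@reindex_esum _ _ _ (setT `*`` (fun _ => setT)) _
  (fun x : J * I => (x.2, x.1)))//.
split => //=.
- by move=> [i1 i2] [j1 j2] /= _ _ [] -> ->.
- by move=> [i1 i2] _; exists (i2, i1).
Qed.

Lemma esum_pair (I J : choiceType) (a : I -> J -> \bar R) :
  (forall i j, 0 <= a i j)%E ->
  (\esum_(i in setT) \esum_(j in setT) a i j = \esum_(p in setT) a p.1 p.2)%E.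
Proof.
move=> a0; rewrite esum_esum//; congr esum.
by apply/seteqP; split.
Qed.

Lemma bij_setT (I J : Type) (e : I -> J) : bijective e -> set_bij setT setT e.
Proof.
move=> [g eK gK]; split => //.
- by move=> x y _ _ /(congr1 g); rewrite !eK.
- by move=> y _; exists (g y) => //; rewrite gK.
Qed.

Lemma esum_bij (I J : choiceType) (e : I -> J) (a : J -> \bar R) :
  bijective e ->
  (\esum_(j in setT) a j = \esum_(i in setT) a (e i))%E.
Proof. by move=> /bij_setT; exact: reindex_esum. Qed.

Lemma le_term_esum (I : choiceType) (a : I -> \bar R) i :
  (forall i, 0 <= a i)%E -> (a i <= \esum_(i in setT) a i)%E.
Proof.
move=> a0; rewrite -(@esum_set1 R _ i a)// [leLHS]esum_mkcond.
by apply: le_esum => j _; case: ifP.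
Qed.

Lemma esum_fin (I : choiceType) (a : I -> \bar R) (ai : (forall i, 0 <= a i)%E) :
  (\esum_(i in setT) a i < +oo)%E ->
  forall i, a i \is a fin_num.
Proof.
by move=> h i; rewrite ge0_fin_numE// (le_lt_trans _ h)// le_term_esum.
Qed.

End EsumComplements.

Section RealSums.
Variable R : realType.
Implicit Types I J : choiceType.

Definition asum I (f : I -> R) : \bar R := (\esum_(i in setT) `|f i|%:E)%E.

(** [rsum] is defined through positive and negative parts. That any summable non-negative splitting
    gives the same value is what linearity rests on. *)
Lemma rsum_sub I (g h : I -> R) : (forall i, 0 <= g i) -> (forall i, 0 <= h i) ->
  (\esum_(i in setT) (g i)%:E < +oo)%E -> (\esum_(i in setT) (h i)%:E < +oo)%E ->
  rsum setT (fun i => g i - h i) =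
  fine (\esum_(i in setT) (g i)%:E) - fine (\esum_(i in setT) (h i)%:E).
Proof.
move=> g0 h0 gs hs.
have e0 (k : I -> R) : (forall i, 0 <= k i) -> (0 <= \esum_(i in setT) (k i)%:E)%E.
  by move=> k0; apply: esum_ge0 => i _; rewrite lee_fin.
rewrite /rsum.
have -> : (EFin \o (fun i => g i - h i)) = ((EFin \o g) \- (EFin \o h))%E.
  by apply/funext => i /=; rewrite EFinB.
rewrite esumB//; last first.
- by move=> i _ /=; rewrite lee_fin.
- by move=> i _ /=; rewrite lee_fin.
- rewrite /summable; under eq_esum do rewrite /= ger0_norm//; exact: hs.
- rewrite /summable; under eq_esum do rewrite /= ger0_norm//; exact: gs.
by rewrite fineB// ge0_fin_numE// ?e0.
Qed.

Lemma asum_ge0 I (f : I -> R) : (0 <= asum f)%E.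
Proof. by apply: esum_ge0 => i _; rewrite lee_fin. Qed.

Lemma asumZ I (c : R) (f : I -> R) : asum (fun i => c * f i) = (`|c|%:E * asum f)%E.
Proof.
rewrite /asum -esumZl//.
by apply: eq_esum => i _; rewrite normrM EFinM.
Qed.

Lemma asumZ_fin I c (f : I -> R) : (asum f < +oo)%E ->
  (asum (fun i => c * f i)%R < +oo)%E.
Proof. by move=> hf; rewrite asumZ lte_mul_pinfty// ?asum_ge0// lee_fin. Qed.

Lemma pos_asum_fin I (f : I -> R) : (asum f < +oo)%E ->
  (\esum_(i in setT) (`|f i| + f i)%:E < +oo)%E.
Proof.
move=> hf; apply: le_lt_trans (_ : asum (fun i => 2 * f i)%R < +oo)%E; last first.
  exact: asumZ_fin.
apply: le_esum => i _; rewrite lee_fin normrM.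
by have := ler_norm (f i); rewrite ger0_norm//; lra.
Qed.

Lemma pos_ge0 (x : R) : 0 <= `|x| + x.
Proof. by have := ler_norm (- x); rewrite normrN; lra. Qed.

(* The decomposition [f = (|f| + f) - |f|] into non-negative families reduces
   every statement on signed sums to [esum]. *)
Lemma rsumE I (f : I -> R) : (asum f < +oo)%E ->
  rsum setT f = fine (\esum_(i in setT) (`|f i| + f i)%:E) - fine (asum f).
Proof.
move=> hf; rewrite -rsum_sub//; last exact: pos_asum_fin.
- by congr rsum; apply/funext => i; rewrite addrAC subrr add0r.
- by move=> i; exact: pos_ge0.
Qed.

Lemma rsumD I (f g : I -> R) : (asum f < +oo)%E -> (asum g < +oo)%E ->
  rsum setT (fun i => f i + g i) = rsum setT f + rsum setT g.
Proof.
move=> hf hg; rewrite (rsumE hf) (rsumE hg).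
have pf := pos_asum_fin hf; have pg := pos_asum_fin hg.
have p0 (x : R) := pos_ge0 x.
rewrite addrACA -opprD -!fineD//; last 4 first.
- by rewrite ge0_fin_numE// esum_ge0.
- by rewrite ge0_fin_numE// esum_ge0.
- by rewrite ge0_fin_numE// esum_ge0// => i _; rewrite lee_fin.
- by rewrite ge0_fin_numE// esum_ge0// => i _; rewrite lee_fin.
rewrite /asum -!esumD//; try by move=> i _; rewrite lee_fin.
rewrite -rsum_sub//.
- by congr rsum; apply/funext => i; ring.
- by move=> i; rewrite addr_ge0.
- under eq_esum do rewrite EFinD.
  by rewrite esumD => [|i _|i _]; rewrite ?lee_fin// lte_add_pinfty.
- under eq_esum do rewrite EFinD.
  by rewrite esumD => [|i _|i _]; rewrite ?lee_fin// lte_add_pinfty.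
Qed.

Lemma rsumN I (f : I -> R) : (asum f < +oo)%E ->
  rsum setT (fun i => - f i) = - rsum setT f.
Proof.
move=> hf; apply/eqP; rewrite -addr_eq0 -rsumD//; last first.
  by rewrite /asum; under eq_esum do rewrite normrN.
have -> : (fun i => - f i + f i) = (fun i => 0 - 0).
  by apply/funext => i; rewrite addNr subrr.
by rewrite rsum_sub ?subrr// esum1.
Qed.

Lemma rsumZ I c (f : I -> R) : (asum f < +oo)%E ->
  rsum setT (fun i => c * f i) = c * rsum setT f.
Proof.
wlog c0 : c f / 0 <= c => [wlg hf|].
  have [c0|c0] := leP 0 c; first exact: wlg.
  have -> : (fun i => c * f i) = (fun i => - (- c * f i)).
    by apply/funext => i; rewrite mulNr opprK.
  rewrite rsumN; last exact: asumZ_fin.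
  by rewrite wlg ?mulNr ?opprK// oppr_ge0 ltW.
move=> hf; rewrite (rsumE hf) -[c in RHS]/(fine c%:E) mulrBr.
rewrite -!fineM ?ge0_fin_numE ?asum_ge0 ?ltry//; last 2 first.
- exact: pos_asum_fin.
- by rewrite esum_ge0// => i _; rewrite lee_fin pos_ge0.
rewrite -esumZl// => [|i]; last by rewrite lee_fin pos_ge0.
rewrite (_ : c%:E * asum f = \esum_(i in setT) (c * `|f i|)%:E)%E; last first.
  by rewrite -esumZl// => i; rewrite lee_fin.
rewrite -rsum_sub//.
- by congr rsum; apply/funext => i; ring.
- by move=> i; rewrite mulr_ge0// pos_ge0.
- by move=> i; rewrite mulr_ge0.
- under eq_esum do rewrite EFinM.
  rewrite esumZl// => [|i]; last by rewrite lee_fin pos_ge0.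
  by rewrite lte_mul_pinfty ?lee_fin//; exact: pos_asum_fin.
- under eq_esum do rewrite EFinM.
  by rewrite esumZl// lte_mul_pinfty ?lee_fin//.
Qed.

Lemma rsum_norm I (f : I -> R) : (asum f < +oo)%E ->
  (`|rsum setT f|%:E <= asum f)%E.
Proof.
move=> hf; rewrite -[asum f]fineK ?ge0_fin_numE ?asum_ge0//.
have le_rsum (g : I -> R) : (asum g < +oo)%E -> rsum setT g <= fine (asum g).
  move=> hg; rewrite (rsumE hg) lerBlDr.
  rewrite -fineD ?ge0_fin_numE ?asum_ge0// fine_le//.
  - by rewrite ge0_fin_numE ?pos_asum_fin// esum_ge0// => i _; rewrite lee_fin pos_ge0.
  - by rewrite fin_numD !ge0_fin_numE ?asum_ge0// hg.
  rewrite /asum -esumD//; apply: le_esum => i _.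
  by rewrite -EFinD lee_fin lerD2l ler_norm.
rewrite lee_fin ler_norml -[X in - X <= _]opprK lerNl -rsumN// !opprK le_rsum// andbT.
have -> : asum f = asum (fun i => - f i).
  by rewrite /asum; under [RHS]eq_esum do rewrite normrN.
by rewrite le_rsum// /asum; under eq_esum do rewrite normrN.
Qed.

(** Reduces Fubini for signed families to Tonelli: only two non-negative double sums remain to be
    exchanged or paired. *)
Lemma rsum_iter I J (g : I -> J -> R) :
  (\esum_(i in setT) \esum_(j in setT) `|g i j|%:E < +oo)%E ->
  rsum setT (fun i => rsum setT (g i)) =
  fine (\esum_(i in setT) \esum_(j in setT) (`|g i j| + g i j)%:E)%E -
  fine (\esum_(i in setT) \esum_(j in setT) `|g i j|%:E)%E.
Proof.
move=> hg; have gi i : (asum (g i) < +oo)%E.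
  by rewrite -ge0_fin_numE ?asum_ge0//; apply: esum_fin hg i => i; exact: asum_ge0.
have p0 i : (0 <= \esum_(j in setT) (`|g i j| + g i j)%:E)%E.
  by rewrite esum_ge0// => j _; rewrite lee_fin pos_ge0.
have pfin i : \esum_(j in setT) (`|g i j| + g i j)%:E \is a fin_num.
  by rewrite ge0_fin_numE// pos_asum_fin.
have nfin i : \esum_(j in setT) `|g i j|%:E \is a fin_num.
  by rewrite ge0_fin_numE ?asum_ge0//; exact: gi.
under [in LHS]eq_fun do rewrite rsumE//.
have pE : \esum_(i in setT) (fine (\esum_(j in setT) (`|g i j| + g i j)%:E))%:E =
          \esum_(i in setT) \esum_(j in setT) (`|g i j| + g i j)%:E.
  by apply: eq_esum => i _; rewrite fineK.
have nE : \esum_(i in setT) (fine (asum (g i)))%:E =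
          \esum_(i in setT) \esum_(j in setT) `|g i j|%:E.
  by apply: eq_esum => i _; rewrite fineK//; exact: nfin.
rewrite rsum_sub ?pE ?nE//; first by move=> i; rewrite fine_ge0.
- by move=> i; rewrite fine_ge0// asum_ge0.
apply: le_lt_trans (_ : 2%:E * (\esum_(i in setT) \esum_(j in setT) `|g i j|%:E) < +oo)%E;
  last by rewrite lte_mul_pinfty.
rewrite -esumZl// => [|i]; last exact: asum_ge0.
apply: le_esum => i _; rewrite -esumZl//; apply: le_esum => j _.
by rewrite -EFinM lee_fin mulr_natl mulr2n lerD2l ler_norm.
Qed.

Lemma rsum_swap I J (f : I -> J -> R) :
  (\esum_(i in setT) \esum_(j in setT) `|f i j|%:E < +oo)%E ->
  rsum setT (fun i => rsum setT (f i)) = rsum setT (fun j => rsum setT (f^~ j)).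
Proof.
move=> hf; rewrite !rsum_iter//; last by rewrite esum_swap// => *; rewrite lee_fin.
by congr (fine _ - fine _); rewrite esum_swap// => *; rewrite lee_fin ?pos_ge0.
Qed.

Lemma rsum_pair I J (f : I -> J -> R) :
  (\esum_(i in setT) \esum_(j in setT) `|f i j|%:E < +oo)%E ->
  rsum setT (fun p => f p.1 p.2) = rsum setT (fun i => rsum setT (f i)).
Proof.
move=> hf; rewrite rsum_iter//.
have p0 i j : (0 <= (`|f i j| + f i j)%:E)%E by rewrite lee_fin pos_ge0.
rewrite (esum_pair p0) (@esum_pair _ _ _ (fun i j => `|f i j|%:E))//.
rewrite rsumE// /asum.
by rewrite -(@esum_pair _ _ _ (fun i j => `|f i j|%:E)).
Qed.

Lemma rsum_reindex I J (P : set I) (Q : set J) (e : I -> J) (f : J -> R) :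
  set_bij P Q e -> rsum Q f = rsum P (f \o e).
Proof.
move=> be; rewrite /rsum !(reindex_esum _ _ _ _ be).
by congr (fine (_ - _)); apply: eq_esum => i _; rewrite ?funeposE ?funenegE.
Qed.

Lemma rsum_mkcond I (D : set I) (f : I -> R) :
  rsum D f = rsum setT (fun i => if i \in D then f i else 0).
Proof.
rewrite /rsum [X in (X - _)%E]esum_mkcond [X in (_ - X)%E]esum_mkcond.
congr (fine (_ - _)); apply: eq_esum => i _; rewrite ?funeposE ?funenegE /=;
  case: ifP => // _; rewrite ?oppe0 ?oppr0 ?maxxx//.
Qed.

Lemma rsum_set1 I i (f : I -> R) : rsum [set i] f = f i.
Proof.
rewrite /rsum !esum_set1 ?funeneg_ge0 ?funepos_ge0//.
by have /(congr1 (fun g => fine (g i))) := funeposneg (EFin \o f).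
Qed.

End RealSums.


(** * Moduli, real and imaginary parts *)

Section Normc.
Variable R : realType.
Implicit Types (z w : R[i]) (x : R).

Lemma normc_ge0 z : 0 <= normc z.
Proof. by case: z => a b /=; rewrite sqrtr_ge0. Qed.

Lemma normcR x : normc x%:C = `|x|.
Proof. by rewrite /= expr0n addr0 sqrtr_sqr. Qed.

Lemma sqr_normc2 z : normc z ^+ 2 = complex.Re z ^+ 2 + complex.Im z ^+ 2.
Proof. by case: z => a b /=; rewrite sqr_sqrtr// addr_ge0 ?sqr_ge0. Qed.

Lemma normr_Re_le z : `|complex.Re z| <= normc z.
Proof.
rewrite -(@ler_pXn2r _ 2) ?nnegrE ?normc_ge0// sqr_normc2 real_normK ?num_real//.
by rewrite lerDl sqr_ge0.
Qed.

Lemma normr_Im_le z : `|complex.Im z| <= normc z.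
Proof.
rewrite -(@ler_pXn2r _ 2) ?nnegrE ?normc_ge0// sqr_normc2 real_normK ?num_real//.
by rewrite lerDr sqr_ge0.
Qed.

Lemma normcX z n : normc (z ^+ n) = normc z ^+ n.
Proof.
elim: n => [|n IH]; first by rewrite !expr0 Normc.normc1.
by rewrite !exprS Normc.normcM IH.
Qed.

Lemma normc_conj z : normc z^*%C = normc z.
Proof. by case: z => a b /=; rewrite sqrrN. Qed.

Lemma Re_conjM z : complex.Re (z^*%C * z) = normc z ^+ 2.
Proof. by rewrite sqr_normc2; case: z => a b /=; ring. Qed.

Lemma Re_addc z w : complex.Re (z + w) = complex.Re z + complex.Re w.
Proof. by case: z; case: w. Qed.

Lemma Im_addc z w : complex.Im (z + w) = complex.Im z + complex.Im w.
Proof. by case: z; case: w. Qed.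

Lemma Re_mulc z w : complex.Re (z * w) =
  complex.Re z * complex.Re w - complex.Im z * complex.Im w.
Proof. by case: z; case: w. Qed.

Lemma Im_mulc z w : complex.Im (z * w) =
  complex.Re z * complex.Im w + complex.Im z * complex.Re w.
Proof. by case: z; case: w. Qed.

Lemma ComplexReIm z : Complex (complex.Re z) (complex.Im z) = z.
Proof. by case: z. Qed.

End Normc.

(** * Absolutely convergent complex sums *)

Section ComplexSums.
Variable R : realType.
Implicit Types I J : choiceType.

Definition l1 I (f : I -> R[i]) : \bar R := (\esum_(i in setT) (normc (f i))%:E)%E.

Lemma csummableE I (f : I -> R[i]) : csummable setT f <-> (l1 f < +oo)%E.
Proof.
rewrite /csummable /summable /l1; under eq_esum do
  rewrite abse_EFin ger0_norm ?normc_ge0//.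
by [].
Qed.

Lemma l1_ge0 I (f : I -> R[i]) : (0 <= l1 f)%E.
Proof. by apply: esum_ge0 => i _; rewrite lee_fin normc_ge0. Qed.

Lemma l1Z I z (f : I -> R[i]) : l1 (fun i => z * f i) = ((normc z)%:E * l1 f)%E.
Proof.
rewrite /l1 -esumZl ?normc_ge0// => [|i]; last by rewrite lee_fin normc_ge0.
by apply: eq_esum => i _; rewrite Normc.normcM EFinM.
Qed.

Lemma l1D I (f g : I -> R[i]) : (l1 (fun i => f i + g i)%R <= l1 f + l1 g)%E.
Proof.
rewrite /l1 -esumD => [|i _|i _]; rewrite ?lee_fin ?normc_ge0//.
by apply: le_esum => i _; rewrite -EFinD lee_fin le_normcD.
Qed.

Lemma l1Z_fin I c (f : I -> R[i]) : (l1 f < +oo)%E ->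
  (l1 (fun i => c * f i)%R < +oo)%E.
Proof. by move=> hf; rewrite l1Z lte_mul_pinfty// ?l1_ge0// lee_fin normc_ge0. Qed.

Lemma l1_le_fin I (f g : I -> R[i]) : (forall i, normc (f i) <= normc (g i)) ->
  (l1 g < +oo)%E -> (l1 f < +oo)%E.
Proof. by move=> h; apply: le_lt_trans; apply: le_esum => i _; rewrite lee_fin. Qed.

Lemma l1_bij I J (e : I -> J) (f : J -> R[i]) : bijective e ->
  l1 f = l1 (f \o e).
Proof. by move=> be; rewrite /l1 (esum_bij _ be). Qed.

Lemma asum_Re I (f : I -> R[i]) : (l1 f < +oo)%E ->
  (asum (fun i => complex.Re (f i)) < +oo)%E.
Proof.
by apply: le_lt_trans; apply: le_esum => i _; rewrite lee_fin normr_Re_le.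
Qed.

Lemma asum_Im I (f : I -> R[i]) : (l1 f < +oo)%E ->
  (asum (fun i => complex.Im (f i)) < +oo)%E.
Proof.
by apply: le_lt_trans; apply: le_esum => i _; rewrite lee_fin normr_Im_le.
Qed.

Lemma csumD I (f g : I -> R[i]) : (l1 f < +oo)%E -> (l1 g < +oo)%E ->
  csum setT (fun i => f i + g i) = csum setT f + csum setT g.
Proof.
move=> hf hg; rewrite /csum; congr Complex.
  rewrite -(rsumD (asum_Re hf) (asum_Re hg)); congr rsum.
  by apply/funext => i; rewrite Re_addc.
rewrite -(rsumD (asum_Im hf) (asum_Im hg)); congr rsum.
by apply/funext => i; rewrite Im_addc.
Qed.

Lemma csumZ I z (f : I -> R[i]) : (l1 f < +oo)%E ->
  csum setT (fun i => z * f i) = z * csum setT f.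
Proof.
move=> hf; have hr := asum_Re hf; have hi := asum_Im hf.
rewrite /csum -{3}(ComplexReIm z); congr Complex.
- rewrite -mulNr -(rsumZ _ hr) -(rsumZ _ hi).
  rewrite -(rsumD (asumZ_fin _ hr) (asumZ_fin _ hi)); congr rsum.
  by apply/funext => i; rewrite Re_mulc mulNr.
- rewrite -(rsumZ _ hr) -(rsumZ _ hi).
  rewrite -(rsumD (asumZ_fin _ hi) (asumZ_fin _ hr)); congr rsum.
  by apply/funext => i; rewrite Im_mulc.
Qed.

(* With [s] the sum, [|s|^2] is the real part of the sum of [conj s * f i]. *)
Lemma csum_norm I (f : I -> R[i]) : ((normc (csum setT f))%:E <= l1 f)%E.
Proof.
have [->|/eqP s0] := eqVneq (csum setT f) 0.
  by rewrite Normc.normc0 l1_ge0.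
have [hf|] := ltP (l1 f) +oo%E; last by rewrite leye_eq => /eqP ->; rewrite leey.
set s := csum setT f in s0 *.
have n0 : 0 < normc s.
  rewrite lt_neqAle normc_ge0 andbT; apply/eqP => /esym/Normc.eq0_normc.
  exact: s0.
rewrite -[l1 f]fineK ?ge0_fin_numE ?l1_ge0// lee_fin.
rewrite -(ler_pM2l n0) -expr2 -Re_conjM /s -csumZ//.
have hZ := l1Z_fin s^*%C hf.
apply: le_trans (ler_norm _) _.
rewrite -lee_fin EFinM fineK ?ge0_fin_numE ?l1_ge0//.
apply: le_trans (rsum_norm (asum_Re hZ)) _.
rewrite -(normc_conj s) -l1Z; apply: le_esum => i _.
by rewrite lee_fin normr_Re_le.
Qed.

Lemma csum_swap I J (f : I -> J -> R[i]) :
  (\esum_(i in setT) \esum_(j in setT) (normc (f i j))%:E < +oo)%E ->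
  csum setT (fun i => csum setT (f i)) = csum setT (fun j => csum setT (f^~ j)).
Proof.
move=> hf; rewrite /csum /=; congr Complex; apply: rsum_swap.
  apply: le_lt_trans hf; apply: le_esum => i _; apply: le_esum => j _.
  by rewrite lee_fin normr_Re_le.
apply: le_lt_trans hf; apply: le_esum => i _; apply: le_esum => j _.
by rewrite lee_fin normr_Im_le.
Qed.

Lemma csum_pair I J (f : I -> J -> R[i]) :
  (\esum_(i in setT) \esum_(j in setT) (normc (f i j))%:E < +oo)%E ->
  csum setT (fun p => f p.1 p.2) = csum setT (fun i => csum setT (f i)).
Proof.
move=> hf; rewrite /csum /=; congr Complex.
  apply: (rsum_pair (f := fun i j => complex.Re (f i j))).
  apply: le_lt_trans hf; apply: le_esum => i _; apply: le_esum => j _.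
  by rewrite lee_fin normr_Re_le.
apply: (rsum_pair (f := fun i j => complex.Im (f i j))).
apply: le_lt_trans hf; apply: le_esum => i _; apply: le_esum => j _.
by rewrite lee_fin normr_Im_le.
Qed.

Lemma csum_reindex I J (P : set I) (Q : set J) (e : I -> J) (f : J -> R[i]) :
  set_bij P Q e -> csum Q f = csum P (f \o e).
Proof. by move=> be; rewrite /csum !(rsum_reindex _ be). Qed.

Lemma csum_bij I J (e : I -> J) (f : J -> R[i]) : bijective e ->
  csum setT f = csum setT (f \o e).
Proof. by move=> /bij_setT; exact: csum_reindex. Qed.

Lemma csum_mkcond I (D : set I) (f : I -> R[i]) :
  csum D f = csum setT (fun i => if i \in D then f i else 0).
Proof.
by rewrite /csum; congr Complex; rewrite rsum_mkcond; congr rsum;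
  apply/funext => i; case: ifP.
Qed.

Lemma csum_set1 I i (f : I -> R[i]) : csum [set i] f = f i.
Proof. by rewrite /csum !rsum_set1 ComplexReIm. Qed.

Lemma csum_delta I i (f : I -> R[i]) : (forall j, j != i -> f j = 0) ->
  csum setT f = f i.
Proof.
move=> f0; rewrite -(csum_set1 i f) [RHS]csum_mkcond; congr csum.
apply/funext => j; case: ifPn => //; rewrite notin_setE => /eqP; exact: f0.
Qed.

Lemma csum0 I : csum setT (fun _ : I => 0) = 0 :> R[i].
Proof.
rewrite /csum /=; have -> : (fun _ : I => 0 : R) = fun=> 0 - 0.
  by apply/funext => i; rewrite subrr.
by rewrite rsum_sub// ?subrr// esum1.
Qed.

(** An inequality, since repeated entries of [s] are counted several times on the right. *)
Lemma l1_finsupp_le I (s : seq I) (f : I -> R[i]) :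
  (l1 (fun i => if i \in s then f i else 0)%R <= (\sum_(i <- s) normc (f i))%:E)%E.
Proof.
elim: s => [|x s IH] /=.
  by rewrite big_nil /l1 esum1// => i _; rewrite Normc.normc0.
rewrite big_cons EFinD; apply: le_trans (leeD2l _ IH).
have <- : l1 (fun i => if i == x then f i else 0) = (normc (f x))%:E.
  rewrite -(@esum_set1 R _ x (fun i => (normc (f i))%:E)) ?lee_fin ?normc_ge0//.
  rewrite [RHS]esum_mkcond; apply: eq_esum => i _.
  have -> : (i \in [set x]) = (i == x) by apply/idP/eqP; rewrite inE.
  by case: eqP => // _; rewrite Normc.normc0.
rewrite /l1 -esumD => [|i _|i _]; rewrite ?lee_fin ?normc_ge0//.
apply: le_esum => i _; rewrite -EFinD lee_fin inE.
case: eqVneq => [->|_]; first by rewrite lerDl normc_ge0.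
by rewrite Normc.normc0 add0r.
Qed.

Lemma l1_finsupp I (s : seq I) (f : I -> R[i]) :
  (l1 (fun i => if i \in s then f i else 0)%R < +oo)%E.
Proof. by apply: le_lt_trans (l1_finsupp_le s f) _; rewrite ltry. Qed.

Lemma csum_finsupp I (s : seq I) (f : I -> R[i]) : uniq s ->
  csum setT (fun i => if i \in s then f i else 0) = \sum_(i <- s) f i.
Proof.
elim: s => [|x s IH] /=; first by rewrite big_nil csum0.
move=> /andP[xs us]; rewrite big_cons -IH//.
have -> : (fun i => if i \in x :: s then f i else 0) =
  (fun i => (if i \in [:: x] then f i else 0) + (if i \in s then f i else 0)).
  apply/funext => i; rewrite !inE; case: eqVneq => [->|_] /=.
    by rewrite (negPf xs) addr0.
  by rewrite add0r.
rewrite csumD ?l1_finsupp//; congr (_ + _).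
rewrite (csum_delta (i := x)) ?inE ?eqxx// => j /negPf jx.
by rewrite inE jx.
Qed.

Lemma csum_split I (s : seq I) (f : I -> R[i]) : uniq s -> (l1 f < +oo)%E ->
  csum setT f = \sum_(i <- s) f i + csum setT (fun i => if i \in s then 0 else f i).
Proof.
move=> us hf; rewrite -csum_finsupp// -csumD ?l1_finsupp//; last first.
  apply: l1_le_fin hf => i; case: ifP => // _.
  by rewrite Normc.normc0 normc_ge0.
by congr csum; apply/funext => i; case: ifP => _; rewrite ?addr0 ?add0r.
Qed.

(** The truncation behind every approximation argument below: continuity of symbols, termwise
    integration, and approximation by trigonometric polynomials. *)
Lemma l1_tail I (f : I -> R[i]) (e : R) : (l1 f < +oo)%E -> 0 < e ->
  exists2 s : seq I, uniq s &
    (l1 (fun i => if i \in s then 0 else f i)%R <= e%:E)%E.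
Proof.
move=> hf e0.
have lfin : l1 f \is a fin_num by rewrite ge0_fin_numE ?l1_ge0.
(* A finite set whose partial sum is within [e] of the supremum leaves a tail of mass at most
   [e]. *)
have /ereal_sup_gt[_ [X [finX _] <-] hX] : (l1 f - e%:E < l1 f)%E.
  by rewrite lteBlDr// lteDl// lte_fin.
exists (finmap.enum_fset (fset_set X)); first exact: finmap.fset_uniq.
have nn i : (0 <= (normc (f i))%:E)%E by rewrite lee_fin normc_ge0.
have := @esumID R _ X setT (fun i => (normc (f i))%:E) (fun i _ => nn i).
rewrite !setTI -[LHS]/(l1 f) esum_fset//.
have -> : (\esum_(i in ~` X) (normc (f i))%:E)%E =
    l1 (fun i => if i \in finmap.enum_fset (fset_set X) then 0 else f i).
  rewrite esum_mkcond; apply: eq_esum => i _.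
  have -> : (i \in finmap.enum_fset (fset_set X)) = (i \in X).
    by rewrite -in_fset_set.
  by rewrite in_setC; case: (i \in X); rewrite ?Normc.normc0.
move: hX lfin => /[swap] + + hl; rewrite hl.
set a := (\sum_(x \in X) _)%E; set b := l1 _.
have a0 : (0 <= a)%E by apply: fsume_ge0.
have b0 : (0 <= b)%E by apply: l1_ge0.
case: a a0 => [a| |] // a0; case: b b0 => [b| |] // b0 _.
by rewrite -[X in (X < _)%E]/((a + b - e)%:E) lte_fin lee_fin; lra.
Qed.

End ComplexSums.


(** * Unordered sums over the naturals as limits of series *)

Section NatSums.
Variable R : realType.

Lemma rsum_cvg (f : nat -> R) : (asum f < +oo)%E ->
  series f @ \oo --> rsum setT f.
Proof.
move=> hf.
have nnc (g : nat -> R) : (forall n, 0 <= g n) ->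
    (\esum_(i in setT) (g i)%:E < +oo)%E ->
    series g @ \oo --> fine (\esum_(i in setT) (g i)%:E)%E.
  move=> g0 hg.
  have h : (fun n => \sum_(0 <= i < n) (g i)%:E)%E @ \oo -->
      (\sum_(0 <= i <oo) (g i)%:E)%E.
    by apply: is_cvg_nneseries => n _ _; rewrite lee_fin.
  move: h; rewrite nneseries_esumT => [|n]; last by rewrite lee_fin.
  rewrite -[X in _ --> X]fineK; last first.
    by rewrite ge0_fin_numE// esum_ge0// => i _; rewrite lee_fin.
  move=> /fine_cvg; rewrite (_ : fine \o _ = series g)//.
  by apply/funext => n /=; rewrite sumEFin.
rewrite (rsumE hf).
have -> : series f =
    (fun n => series (fun i => `|f i| + f i) n - series (fun i => `|f i|) n).
  apply/funext => n; rewrite /series /= -sumrB; apply: eq_bigr => i _.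
  by rewrite addrAC subrr add0r.
apply: cvgB; apply: nnc => //; last exact: pos_asum_fin.
by move=> n; exact: pos_ge0.
Qed.

Lemma series_asum (f : nat -> R) (B : R) :
  (forall n, \sum_(0 <= i < n) `|f i| <= B) -> (asum f <= B%:E)%E.
Proof.
move=> hB; rewrite /asum -nneseries_esumT//.
apply: lime_le; first by apply: is_cvg_nneseries => n _ _; rewrite lee_fin.
by apply: nearW => n; rewrite sumEFin lee_fin.
Qed.

Lemma asum_expR (x : R) : (asum (exp_coeff x) <= (expR `|x|)%:E)%E.
Proof.
apply: series_asum => n.
have -> : \sum_(0 <= i < n) `|exp_coeff x i| = series (exp_coeff `|x|) n.
  rewrite /series /=; apply: eq_bigr => i _; rewrite /exp_coeff /=.
  by rewrite normrM normrX normfV normr_nat.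
apply: nondecreasing_cvgn_le; last exact: is_cvg_series_exp_coeff.
by apply: nondecreasing_series => k _ _; exact: exp_coeff_ge0.
Qed.

End NatSums.

(** * Exponential and logarithmic series *)

Section ComplexExp.
Variable R : realType.
Implicit Types (z w : R[i]).

Definition expc_coeff z (n : nat) : R[i] := z ^+ n * (n`!%:R^-1)%:C.

Lemma normc_expc_coeff z n : normc (expc_coeff z n) = exp_coeff (normc z) n.
Proof. by rewrite Normc.normcM normcX normcR normfV normr_nat. Qed.

Lemma l1_expc z : (l1 (expc_coeff z) <= (expR (normc z))%:E)%E.
Proof.
rewrite -(ger0_norm (normc_ge0 z)); apply: le_trans (asum_expR _).
by apply: le_esum => n _; rewrite lee_fin normc_expc_coeff ler_norm.
Qed.

Lemma l1_expc_fin z : (l1 (expc_coeff z) < +oo)%E.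
Proof. by apply: le_lt_trans (l1_expc z) _; rewrite ltry. Qed.

(** The binomial theorem divided by [n!]; the range is an [iota] so that [csum_finsupp] applies. *)
Lemma expc_coeffD z w n : expc_coeff (z + w) n =
  \sum_(i <- iota 0 n.+1) expc_coeff w i * expc_coeff z (n - i).
Proof.
rewrite /expc_coeff exprDn mulr_suml -/(index_iota 0 n.+1) big_mkord.
apply: eq_bigr => i _; have ni : (i <= n)%N by rewrite -ltnS.
have key : 'C(n, i)%:R * (n`!%:R^-1)%:C =
    (i`!%:R^-1)%:C * ((n - i)`!%:R^-1)%:C :> R[i].
  have bz : 'C(n, i)%:R != 0 :> R by rewrite pnatr_eq0 -lt0n bin_gt0.
  rewrite (_ : 'C(n, i)%:R = ('C(n, i)%:R : R)%:C :> R[i]); last by rewrite rmorph_nat.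
  rewrite -!rmorphM /= -(bin_fact ni) !natrM !invfM; congr (_%:C).
  by rewrite mulVKf.
by rewrite -mulr_natr -!mulrA key; ring.
Qed.

Lemma esum_nat_shift i (g : nat -> \bar R) : (forall n, 0 <= g n)%E ->
  (\esum_(n in setT) (if (i <= n)%N then g (n - i)%N else 0) =
   \esum_(n in setT) g n)%E.
Proof.
move=> g0; have -> : \esum_(n in setT) g n =
    \esum_(n in [set n | (i <= n)%N]) g (n - i)%N.
  rewrite (reindex_esum setT [set n | (i <= n)%N] (addn i)); last first.
    split=> [n _|m n _ _|n /= ni] /=; [exact: leq_addr|exact: addnI|].
    by exists (n - i)%N => //; rewrite subnKC.
  by apply: eq_esum => n _; rewrite addKn.
rewrite [RHS]esum_mkcond; apply: eq_esum => n _.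
by rewrite (_ : (n \in _) = (i <= n)%N)//; apply/idP/idP; rewrite inE.
Qed.

Lemma csum_nat_shift i (g : nat -> R[i]) :
  csum setT (fun n => if (i <= n)%N then g (n - i)%N else 0) = csum setT g.
Proof.
have -> : csum setT g = csum [set n | (i <= n)%N] (fun n => g (n - i)%N).
  rewrite (@csum_reindex _ _ _ setT [set n | (i <= n)%N] (addn i)); last first.
    split=> [n _|m n _ _|n /= ni] /=; [exact: leq_addr|exact: addnI|].
    by exists (n - i)%N => //; rewrite subnKC.
  by congr csum; apply/funext => n /=; rewrite addKn.
rewrite [RHS]csum_mkcond; congr csum; apply/funext => n.
by rewrite (_ : (n \in _) = (i <= n)%N)//; apply/idP/idP; rewrite inE.
Qed.

(** Cauchy product as an exchange of sums: row [n] of the triangular array [F] sums to a coefficient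
    for [z + w], while column [i] is a shifted exponential series of [z] times a coefficient for
    [w]. *)
Lemma csum_expcD z w :
  csum setT (expc_coeff (z + w)) =
  csum setT (expc_coeff z) * csum setT (expc_coeff w).
Proof.
pose F n i := if (i <= n)%N then expc_coeff w i * expc_coeff z (n - i) else 0.
transitivity (csum setT (fun n => csum setT (F n))).
  congr csum; apply/funext => n; rewrite expc_coeffD -csum_finsupp ?iota_uniq//.
  by congr csum; apply/funext => i; rewrite mem_iota add0n leq0n.
have FS i : csum setT (F^~ i) = csum setT (expc_coeff z) * expc_coeff w i.
  rewrite [RHS]mulrC -csumZ ?l1_expc_fin//.
  exact: (csum_nat_shift i (fun m => expc_coeff w i * expc_coeff z m)).
rewrite csum_swap.
  by under [in LHS]eq_fun do rewrite FS; rewrite csumZ ?l1_expc_fin.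
rewrite esum_swap => [|n i]; last by rewrite lee_fin normc_ge0.
have hF i : (\esum_(n in setT) (normc (F n i))%:E =
    (normc (expc_coeff w i))%:E * l1 (expc_coeff z))%E.
  rewrite -l1Z /l1.
  rewrite -(esum_nat_shift i (g := fun m => (normc (expc_coeff w i * expc_coeff z m))%:E)).
    by apply: eq_esum => n _; rewrite /F; case: ifP => // _; rewrite Normc.normc0.
  by move=> n; rewrite lee_fin normc_ge0.
under eq_esum do rewrite hF muleC -[l1 _]fineK ?ge0_fin_numE ?l1_ge0 ?l1_expc_fin//.
rewrite esumZl ?fine_ge0 ?l1_ge0// => [|i]; last by rewrite lee_fin normc_ge0.
by rewrite lte_mul_pinfty ?lee_fin ?fine_ge0 ?l1_ge0//; exact: l1_expc_fin.
Qed.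

Lemma csum_expc_real (x : R) : csum setT (expc_coeff x%:C) = (expR x)%:C.
Proof.
have hf : (asum (exp_coeff x) < +oo)%E by apply: le_lt_trans (asum_expR x) _; rewrite ltry.
have E n : expc_coeff x%:C n = (exp_coeff x n)%:C.
  by rewrite /expc_coeff -rmorphXn /= -rmorphM.
rewrite /csum; congr Complex.
  under eq_fun do rewrite E; rewrite -(cvg_lim _ (rsum_cvg hf))//.
under eq_fun do rewrite E /=.
have := csum0 R nat; rewrite /csum => -[_]; exact.
Qed.

(** Parity factors and halved exponents follow the shape of [cos_coeff] and [sin_coeff], so that the
    series can be matched term by term. *)
Lemma expr_iM (y : R) n : (Complex 0 y) ^+ n =
  Complex ((~~ odd n)%:R * (-1) ^+ n./2 * y ^+ n) ((odd n)%:R * (-1) ^+ n.-1./2 * y ^+ n).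
Proof.
have even k : (Complex 0 y) ^+ k.*2 = ((-1) ^+ k * y ^+ k.*2)%:C.
  rewrite -muln2 mulnC !exprM -exprMn rmorphXn; congr (_ ^+ _).
  by rewrite expr2; apply/eqP; rewrite eq_complex /=; apply/andP; split; apply/eqP; ring.
rewrite -(odd_double_half n) oddD odd_double addbF; case: (odd n) => /=.
  rewrite add1n /= uphalf_double half_double exprS even !mul0r !mul1r.
  by apply/eqP; rewrite eq_complex /= exprS; apply/andP; split; apply/eqP; ring.
rewrite add0n half_double even mul0r mul1r.
by apply/eqP; rewrite eq_complex /= mul0r !eqxx.
Qed.

Lemma csum_expc_im (y : R) :
  csum setT (expc_coeff (Complex 0 y)) = Complex (cos y) (sin y).
Proof.
have E n : expc_coeff (Complex 0 y) n = Complex (cos_coeff y n) (sin_coeff y n).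
  rewrite /expc_coeff expr_iM /cos_coeff /sin_coeff /=.
  by congr Complex; rewrite mulr0 ?subr0 ?add0r.
have hf := l1_expc_fin (Complex 0 y).
rewrite /csum cos.unlock sin.unlock; congr Complex.
  rewrite -(cvg_lim _ (rsum_cvg (asum_Re hf)))//; congr (lim (series _ @ \oo)).
  by apply/funext => n; rewrite E.
rewrite -(cvg_lim _ (rsum_cvg (asum_Im hf)))//; congr (lim (series _ @ \oo)).
by apply/funext => n; rewrite E.
Qed.

(** Ties the polar definition of [cexp] to the power series, the form that can be summed in the
    Wiener algebra. *)
Lemma csum_expc z : csum setT (expc_coeff z) = cexp z.
Proof.
case: z => x y; have -> : Complex x y = x%:C + Complex 0 y.
  by apply/eqP; rewrite eq_complex /= addr0 add0r !eqxx.
rewrite csum_expcD csum_expc_real csum_expc_im /= addr0 add0r.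
by apply/eqP; rewrite eq_complex /=; apply/andP; split; apply/eqP; ring.
Qed.

Lemma cexpD z w : cexp (z + w) = cexp z * cexp w.
Proof. by rewrite -!csum_expc csum_expcD. Qed.

Lemma cexp0 : cexp 0 = 1 :> R[i].
Proof. by rewrite /= expR0 cos0 sin0 mulr1 mulr0. Qed.

End ComplexExp.


Section LogSeries.
Variable R : realType.

(** Index [n] carries the term of degree [n + 1], as the series of [- ln (1 - x)] has no constant
    term. *)
Definition ln_coeff (x : R) (n : nat) : R := x ^+ n.+1 / n.+1%:R.

(* The derivative of the remainder of the series telescopes, so that the mean
   value theorem bounds the remainder by a geometric sequence. *)
Lemma is_derive_ln_remainder N (x : R) : x < 1 ->
  is_derive x 1 (fun y => ln (1 - y) + series (ln_coeff y) N) (- (x ^+ N / (1 - x))).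
Proof.
move=> x1; have x0 : 0 < 1 - x by rewrite subr_gt0.
have x0' : 1 - x != 0 by rewrite gt_eqF.
elim: N => [|N IH].
  have -> : (fun y => ln (1 - y) + series (ln_coeff y) 0) = (fun y : R => ln (1 - y)).
    by apply/funext => y; rewrite /series /= big_geq// addr0.
  have dl : is_derive (1 - x) 1 (@ln R) (1 - x)^-1 by exact: is_derive1_ln.
  have ds : is_derive x 1 (fun y : R => 1 - y) (-1).
    by apply: is_derive_eq; rewrite add0r mul1r.
  have := @is_derive1_comp _ (@ln R) (fun y => 1 - y) x _ _ dl ds.
  by rewrite expr0 mulrN1 mul1r.
have -> : (fun y => ln (1 - y) + series (ln_coeff y) N.+1) =
    (fun y => ln (1 - y) + series (ln_coeff y) N) \+ (fun y => ln_coeff y N).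
  by apply/funext => y /=; rewrite /series /= big_nat_recr//= addrA.
have dX : is_derive x 1 (fun y => ln_coeff y N) (x ^+ N).
  have d1 : is_derive x 1 (@GRing.exp R ^~ N.+1) (N.+1%:R * x ^+ N).
    split; first exact: exprn_derivable.
    by rewrite exp_derive /GRing.scale /= mulr1.
  have := @is_deriveZ _ _ _ _ N.+1%:R^-1 x 1 _ d1.
  rewrite /GRing.scale /= mulKf ?pnatr_eq0//.
  rewrite (_ : _ \*: _ = fun y => ln_coeff y N)//.
  by apply/funext => y; rewrite /ln_coeff mulrC.
apply: is_derive_eq; rewrite exprS; field.
exact: x0'.
Qed.

Lemma ln_series_cvg (x : R) : 0 <= x < 1 ->
  series (ln_coeff x) @ \oo --> - ln (1 - x).
Proof.
move=> /andP[x0 x1]; have x1' : 0 < 1 - x by rewrite subr_gt0.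
have bound N : `|- ln (1 - x) - series (ln_coeff x) N| <= x ^+ N * (1 - x)^-1.
  pose g (y : R) := ln (1 - y) + series (ln_coeff y) N.
  have dg (y : R) : y < 1 -> is_derive y 1 g (- (y ^+ N / (1 - y))).
    exact: is_derive_ln_remainder.
  have [||c] := @MVT_segment _ g (fun y => - (y ^+ N / (1 - y))) 0 x x0.
  - by move=> y; rewrite in_itv /= => /andP[_ /lt_trans/(_ x1)]; exact: dg.
  - apply: derivable_within_continuous => y; rewrite in_itv /= => /andP[_ yx].
    exact/ex_derive/dg/(le_lt_trans yx).
  rewrite in_itv /= => /andP[c0 cx].
  have g0 : g 0 = 0.
    rewrite /g subr0 ln1 add0r /series /= big1// => i _.
    by rewrite /ln_coeff exprS mul0r mul0r.
  rewrite g0 subr0 => gx; rewrite -opprD normrN -/(g x) gx subr0 normrM normrN.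
  have c1 : 0 < 1 - c by rewrite subr_gt0 (le_lt_trans cx).
  have cN : 0 <= c ^+ N / (1 - c) by rewrite divr_ge0 ?exprn_ge0 ?(ltW c1).
  rewrite (ger0_norm cN) (ger0_norm x0).
  apply: (@le_trans _ _ (c ^+ N / (1 - c))).
    by rewrite ler_piMr// ltW.
  apply: ler_pM; rewrite ?exprn_ge0 ?invr_ge0 ?(ltW c1)//.
    by rewrite lerXn2r.
  by rewrite lef_pV2 ?posrE// lerD2l lerN2.
have hz : (fun N => x ^+ N * (1 - x)^-1) @ \oo --> 0.
  rewrite -[X in _ --> X](mul0r (1 - x)^-1).
  by apply: cvgMl; apply: cvg_expr; rewrite ger0_norm.
apply/cvgrPdist_le => e e0.
move/cvgrPdist_le : hz => /(_ e e0); apply: filterS => N /=.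
rewrite sub0r normrN ger0_norm ?mulr_ge0 ?exprn_ge0 ?invr_ge0 ?(ltW x1')//.
exact: le_trans.
Qed.

Lemma asum_ln (x : R) : 0 <= x < 1 -> (asum (ln_coeff x) < +oo)%E.
Proof.
move=> x01; apply: le_lt_trans (_ : (- ln (1 - x))%:E < +oo)%E; last exact: ltry.
have /andP[x0 _] := x01.
have c0 i : 0 <= ln_coeff x i by rewrite /ln_coeff divr_ge0// exprn_ge0.
apply: series_asum => n; rewrite -(cvg_lim _ (ln_series_cvg x01))//.
under eq_bigr do rewrite ger0_norm//.
apply: (@nondecreasing_cvgn_le _ (series (ln_coeff x))).
  by apply: nondecreasing_series => k _ _.
by apply/cvg_ex; eexists; exact: ln_series_cvg.
Qed.

Lemma rsum_ln (x : R) : 0 <= x < 1 -> rsum setT (ln_coeff x) = - ln (1 - x).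
Proof.
move=> x01; rewrite -(cvg_lim _ (ln_series_cvg x01))//.
by rewrite -(cvg_lim _ (rsum_cvg (asum_ln x01))).
Qed.

End LogSeries.


(** * Fourier coefficients *)

Section Characters.
Variable R : realType.

Definition e1 (s : R) : R[i] := cexp (Complex 0 (2 * pi * s)).

Lemma e1E s : e1 s = Complex (cos (2 * pi * s)) (sin (2 * pi * s)).
Proof. by rewrite /e1 /= expR0 !mul1r. Qed.

Lemma e1D s t : e1 (s + t) = e1 s * e1 t.
Proof.
rewrite /e1 -cexpD; congr cexp.
by apply/eqP; rewrite eq_complex /= addr0 eqxx mulrDr eqxx.
Qed.

Lemma e10 : e1 0 = 1.
Proof. by rewrite e1E mulr0 cos0 sin0. Qed.

Lemma normc_e1 s : normc (e1 s) = 1.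
Proof. by rewrite e1E /= cos2Dsin2 sqrtr1. Qed.

Lemma e1_neq0 s : e1 s != 0.
Proof.
apply/eqP => h; have := normc_e1 s; rewrite h Normc.normc0.
by move/esym/eqP; rewrite oner_eq0.
Qed.

Lemma e1N s : e1 (- s) = (e1 s)^-1.
Proof.
by apply: (mulfI (e1_neq0 s)); rewrite -e1D subrr e10 mulfV// e1_neq0.
Qed.

Lemma e1_expz s (m : int) : e1 s ^ m = e1 (m%:~R * s).
Proof.
have nat_case k : e1 s ^+ k = e1 (k%:R * s).
  elim: k => [|k IH]; first by rewrite mul0r e10.
  by rewrite exprS IH -e1D -natr1 mulrDl mul1r addrC.
case: m => k; first by rewrite -exprnP nat_case.
by rewrite NegzE -exprnN nat_case -e1N rmorphN /= mulNr.
Qed.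

Lemma e1_int (m : int) : e1 m%:~R = 1.
Proof.
have := e1_expz 1 m; rewrite mulr1 => <-.
have -> : e1 1 = 1 by rewrite e1E mulr1 mulr_natl cos2pi sin2pi.
by rewrite exp1rz.
Qed.

Variable d : nat.
Implicit Types (k l : lattice d) (t : 'rV[R]_d).

Definition dotp k t : R := \sum_(i < d) (k 0 i)%:~R * t 0 i.

Definition chi k t : R[i] := e1 (dotp k t).

Lemma monomE k t : monom k (torus_point t) = chi k t.
Proof.
rewrite /monom /chi /dotp.
have e1_sum (r : seq 'I_d) (F : 'I_d -> R) :
    e1 (\sum_(i <- r) F i) = \prod_(i <- r) e1 (F i).
  by elim: r => [|a r IH]; rewrite ?big_nil ?e10// !big_cons e1D IH.
rewrite e1_sum; apply: eq_bigr => i _.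
by rewrite -e1_expz /torus_point mxE.
Qed.

Lemma chiD k l t : chi (k + l) t = chi k t * chi l t.
Proof.
rewrite /chi -e1D /dotp -big_split; congr e1; apply: eq_bigr => i _.
by rewrite mxE rmorphD /= mulrDl.
Qed.

Lemma chi0 t : chi 0 t = 1.
Proof. by rewrite /chi /dotp big1 ?e10// => i _; rewrite mxE mul0r. Qed.

Lemma chiN k t : chi (- k) t = chi k (- t).
Proof.
rewrite /chi /dotp; congr e1; apply: eq_bigr => i _.
by rewrite !mxE rmorphN mulNr mulrN.
Qed.

Lemma chiNV k t : chi (- k) t * chi k t = 1.
Proof. by rewrite -chiD addNr chi0. Qed.

Lemma normc_chi k t : normc (chi k t) = 1.
Proof. exact: normc_e1. Qed.

Lemma torus_invE t : torus_inv (torus_point t) = torus_point (- t).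
Proof.
apply/matrixP => i j; rewrite !mxE -!/(e1 _).
by rewrite -e1N.
Qed.

Lemma torus_torus_point t : torus (torus_point t).
Proof.
move=> i; rewrite mxE -/(e1 _) normc_def -sqr_normc2 normc_e1 expr1n.
by rewrite sqrtr1.
Qed.

End Characters.

(** * Orthogonality of characters on the unit interval *)

Section UnitIntegral.
Variable R : realType.

Definition I01 (f : R -> R) : R := \int[lebesgue_measure]_(s in `[0%R, 1%R]) f s.

Lemma cont_integrable (f : R -> R) : continuous f ->
  (@lebesgue_measure R).-integrable `[0%R, 1%R] (EFin \o f).
Proof.
move=> cf; apply: continuous_compact_integrable; first exact: segment_compact.
by apply: continuous_subspaceT.
Qed.

Lemma I01_cst r : I01 (fun=> r) = r.
Proof.
rewrite /I01 Rintegral_cst//.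
have := @lebesgue_measure_itv R `[0%R, 1%R]; rewrite /= lte_fin ltr01 => ->.
by rewrite -EFinB /= subr0 mulr1.
Qed.

Lemma I01D (f g : R -> R) : continuous f -> continuous g ->
  I01 (fun x => f x + g x) = I01 f + I01 g.
Proof. by move=> cf cg; rewrite /I01 RintegralD//; exact: cont_integrable. Qed.

Lemma I01_le (f g : R -> R) : continuous f -> continuous g ->
  (forall x, 0 <= x <= 1 -> f x <= g x) -> I01 f <= I01 g.
Proof.
move=> cf cg fg; apply: le_Rintegral => //; try exact: cont_integrable.
Qed.

Lemma I01_norm_le (f : R -> R) r : continuous f -> (forall x, `|f x| <= r) -> `|I01 f| <= r.
Proof.
move=> cf fr; rewrite ler_norml -{1}(I01_cst (- r)) -{2}(I01_cst r) !I01_le//.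
- by move=> x; exact: cvg_cst.
- by move=> x _; have := fr x; rewrite ler_norml => /andP[].
- by move=> x; exact: cvg_cst.
- by move=> x _; have := fr x; rewrite ler_norml => /andP[].
Qed.

Lemma continuous_trig (a b c : R) :
  continuous (fun x : R => a * cos (c * x) - b * sin (c * x)).
Proof.
have cc : continuous (fun y : R => c * y) by exact: mulrl_continuous.
move=> x; apply: cvgB; apply: cvgMr.
  exact: (continuous_comp (cc x) (@continuous_cos R (c * x))).
exact: (continuous_comp (cc x) (@continuous_sin R (c * x))).
Qed.

Lemma I01_trig (m : int) (a b : R) :
  I01 (fun x => a * cos (2 * pi * (m%:~R * x)) - b * sin (2 * pi * (m%:~R * x))) =
  if m == 0 then a else 0.
Proof.
case: eqP => [->|/eqP m0].
  rewrite -[RHS]I01_cst; congr I01; apply/funext => x.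
  by rewrite mul0r mulr0 cos0 sin0 mulr0 mulr1 subr0.
pose c : R := 2 * pi * m%:~R.
have c0 : c != 0 by rewrite !mulf_neq0 ?pnatr_eq0 ?intr_eq0// gt_eqF// pi_gt0.
(* An antiderivative of the integrand. It agrees at 0 and 1 because [m] is an integer, which enters
   through [e1_int]. *)
pose F x := a * c^-1 * sin (c * x) + b * c^-1 * cos (c * x).
pose f x := a * cos (c * x) - b * sin (c * x).
have dF (x : R) : is_derive x 1 F (f x).
  have dc : is_derive x 1 (fun y : R => c * y) c.
    by apply: is_derive_eq; rewrite /GRing.scale /= mulr1.
  have ds := @is_derive1_comp _ sin (fun y => c * y) x _ _ (is_derive_sin (c * x)) dc.
  have dk := @is_derive1_comp _ cos (fun y => c * y) x _ _ (is_derive_cos (c * x)) dc.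
  have d1 := @is_deriveZ _ _ _ _ (a * c^-1) x 1 _ ds.
  have d2 := @is_deriveZ _ _ _ _ (b * c^-1) x 1 _ dk.
  have := is_deriveD d1 d2.
  rewrite /GRing.scale /= /f.
  have -> : a / c * (cos (c * x) * c) + b / c * (- sin (c * x) * c) =
      a * cos (c * x) - b * sin (c * x) by field.
  by [].
have cF : continuous F.
  have -> : F = (fun x => b * c^-1 * cos (c * x) - (- (a * c^-1)) * sin (c * x)).
    by apply/funext => x; rewrite /F mulNr opprK addrC.
  exact: continuous_trig.
have cf : continuous f by exact: continuous_trig.
rewrite (_ : (fun x => _) = f); last first.
  by apply/funext => x; rewrite /f /c !mulrA.
rewrite /I01 /Rintegral (@continuous_FTC2 _ _ F)//.
- have [hc hs] : cos c = 1 /\ sin c = 0.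
    by have := e1_int R m; rewrite e1E => -[-> ->].
  by rewrite /F -EFinB /= mulr1 mulr0 hc hs sin0 cos0 subrr.
- exact: continuous_subspaceT.
- split.
  + by move=> x _; case: (dF x).
  + exact: cvg_at_right_filter (cF 0).
  + exact: cvg_at_left_filter (cF 1).
- by move=> x _; rewrite derive1E; have := dF x; move=> [].
Qed.

End UnitIntegral.


(** * Continuity of uniformly dominated sums *)

Section CsumContinuity.
Variables (R : realType) (T : topologicalType) (I : choiceType).

Lemma continuous_bigsum (s : seq I) (f : I -> T -> R) :
  (forall i, continuous (f i)) -> continuous (fun x => \sum_(i <- s) f i x).
Proof.
move=> cf; elim: s => [|i s IH].
  have -> : (fun x => \sum_(i <- [::]) f i x) = cst 0.
    by apply/funext => x; rewrite big_nil.
  by move=> x; exact: cvg_cst.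
have -> : (fun x => \sum_(j <- i :: s) f j x) = f i \+ (fun x => \sum_(j <- s) f j x).
  by apply/funext => x; rewrite big_cons.
by move=> x; apply: cvgD; [exact: cf|exact: IH].
Qed.

(** A uniform limit of finite sums: the tail is at most [e / 3] at each of the two points compared,
    and the finite part moves by at most [e / 3]. *)
Lemma Re_csum_continuous (c : I -> R[i]) (g : I -> T -> R[i]) :
  (l1 c < +oo)%E -> (forall i x, normc (g i x) <= 1) ->
  (forall i z, continuous (fun x => complex.Re (z * g i x))) ->
  continuous (fun x => complex.Re (csum setT (fun i => c i * g i x))).
Proof.
move=> hc g1 cg x; apply/cvgrPdist_le => e e0.
have e3 : 0 < e / 3 by rewrite divr_gt0.
have [s us hs] := l1_tail hc e3.
have hcg y : (l1 (fun i => c i * g i y)%R < +oo)%E.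
  by apply: l1_le_fin hc => i; rewrite Normc.normcM ler_piMr ?normc_ge0.
pose tl y := csum setT (fun i => if i \in s then 0 else c i * g i y).
have tl_le y : `|complex.Re (tl y)| <= e / 3.
  apply: le_trans (normr_Re_le _) _; rewrite -lee_fin.
  apply: le_trans (csum_norm _) _; apply: le_trans hs; apply: le_esum => i _.
  rewrite lee_fin; case: ifP => // _.
  by rewrite Normc.normcM ler_piMr ?normc_ge0.
have split y : complex.Re (csum setT (fun i => c i * g i y)) =
    \sum_(i <- s) complex.Re (c i * g i y) + complex.Re (tl y).
  rewrite (csum_split us (hcg y)) Re_addc; congr (_ + _).
  by elim: (s) => [|a r IH]; rewrite ?big_nil// !big_cons Re_addc IH.
have cs : continuous (fun y => \sum_(i <- s) complex.Re (c i * g i y)).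
  exact: continuous_bigsum.
have /cvgrPdist_le/(_ _ e3) := cs x; apply: filterS => y.
rewrite (split x) (split y) => hy.
have := tl_le x; have := tl_le y; move: hy.
rewrite !ler_norml; lra.
Qed.

End CsumContinuity.

(** * Recovering and bounding Fourier coefficients *)

Section FourierCoefficients.
Variable R : realType.

Definition symb1 (c : int -> R[i]) (x : R) : R[i] :=
  csum setT (fun m => c m * e1 (m%:~R * x)).

Definition symb d (c : lattice d -> R[i]) (t : 'rV[R]_d) : R[i] :=
  csum setT (fun k => c k * chi k t).

Lemma Re_Me1 (z : R[i]) x : complex.Re (z * e1 x) =
  complex.Re z * cos (2 * pi * x) - complex.Im z * sin (2 * pi * x).
Proof. by rewrite Re_mulc e1E. Qed.

Lemma continuous_Re_Me1 (m : int) (z : R[i]) :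
  continuous (fun x : R => complex.Re (z * e1 (m%:~R * x))).
Proof.
have -> : (fun x => complex.Re (z * e1 (m%:~R * x))) =
    (fun x => complex.Re z * cos (2 * pi * m%:~R * x)
              - complex.Im z * sin (2 * pi * m%:~R * x)).
  by apply/funext => x; rewrite Re_Me1 !mulrA.
exact: continuous_trig.
Qed.

Lemma symb1_continuous c : (l1 c < +oo)%E ->
  continuous (fun x => complex.Re (symb1 c x)).
Proof.
move=> hc; apply: (@Re_csum_continuous R R int c (fun m x => e1 (m%:~R * x))) => //.
  by move=> m x; rewrite normc_e1.
exact: continuous_Re_Me1.
Qed.

Lemma l1_Mchar (I : choiceType) (c : I -> R[i]) (g : I -> R[i]) : (forall i, normc (g i) = 1) ->
  l1 (fun i => c i * g i) = l1 c.
Proof. by move=> g1; apply: eq_esum => i _; rewrite Normc.normcM g1 mulr1. Qed.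

(** Termwise integration by truncation: orthogonality settles the finite part, and the tail
    contributes at most [e / 2] to the integral and [e / 2] to the coefficient. *)
Lemma I01_symb1 c : (l1 c < +oo)%E ->
  I01 (fun x => complex.Re (symb1 c x)) = complex.Re (c 0).
Proof.
move=> hc; apply/eqP; rewrite eq_sym -subr_eq0; apply/eqP.
apply/eqP; rewrite -normr_le0; apply/ler_addgt0Pl => e e0; rewrite addr0.
have e2 : 0 < e / 2 by rewrite divr_gt0.
have [s us hs] := l1_tail hc e2.
pose c' m := if m \in s then 0 else c m.
have hc' : (l1 c' < +oo)%E by apply: le_lt_trans hs _; rewrite ltry.
have split x : complex.Re (symb1 c x) =
    \sum_(m <- s) complex.Re (c m * e1 (m%:~R * x)) + complex.Re (symb1 c' x).
  rewrite /symb1 (csum_split us) ?l1_Mchar//; last by move=> m; exact: normc_e1.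
  rewrite Re_addc; congr (_ + _).
    by elim: (s) => [|a r IH]; rewrite ?big_nil// !big_cons Re_addc IH.
  by congr (complex.Re (csum _ _)); apply/funext => m; rewrite /c'; case: ifP;
    rewrite ?mul0r.
have cs r : continuous (fun x : R => \sum_(m <- r) complex.Re (c m * e1 (m%:~R * x))).
  by apply: continuous_bigsum => m; exact: continuous_Re_Me1.
have Is : I01 (fun x => \sum_(m <- s) complex.Re (c m * e1 (m%:~R * x))) =
    complex.Re (c 0) - complex.Re (c' 0).
  (* The difference is the coefficient at 0 if the truncation kept index 0, and zero otherwise. *)
  have -> : complex.Re (c 0) - complex.Re (c' 0) =
      \sum_(m <- s) (if m == 0 then complex.Re (c m) else 0).
    rewrite /c'; case: ifPn => s0.
      rewrite [complex.Re 0]/= subr0 (big_rem 0 s0) /= big1_seq ?addr0// => m /andP[_].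
      by rewrite mem_rem_uniq// inE => /andP[/negPf ->].
    rewrite subrr big1_seq// => m /andP[_ ms]; case: eqP => // m0.
    by rewrite m0 (negPf s0) in ms.
  elim: (s) => [|a r IH].
    by under eq_fun do rewrite big_nil; rewrite big_nil I01_cst.
  under eq_fun do rewrite big_cons; rewrite big_cons I01D//; last first.
    exact: continuous_Re_Me1.
  rewrite IH; congr (_ + _); under eq_fun do rewrite Re_Me1.
  exact: I01_trig.
have tl_le x : `|complex.Re (symb1 c' x)| <= e / 2.
  apply: le_trans (normr_Re_le _) _; rewrite -lee_fin.
  apply: le_trans (csum_norm _) _; rewrite l1_Mchar// => m; exact: normc_e1.
have c0_le : `|complex.Re (c' 0)| <= e / 2.
  apply: le_trans (normr_Re_le _) _; rewrite -lee_fin; apply: le_trans hs.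
  by apply: (@le_term_esum _ _ (fun m => (normc (c' m))%:E)) => m; rewrite lee_fin normc_ge0.
have := I01_norm_le (symb1_continuous hc') tl_le; move: c0_le.
rewrite (_ : (fun x => complex.Re (symb1 c x)) = fun x =>
    \sum_(m <- s) complex.Re (c m * e1 (m%:~R * x)) + complex.Re (symb1 c' x)).
  rewrite I01D//; last exact: symb1_continuous.
  by rewrite Is !ler_norml; lra.
by apply/funext => x; exact: split.
Qed.

(** The integer goes in front because the outermost integral of [cube_integral] is over the first
    coordinate; the tail comes first in the pair because it is the outer summation index in
    [symb_cons]. *)
Definition lattice_cons d (p : lattice d * int) : lattice d.+1 :=
  row_mx (const_mx p.2 : 'rV_1) p.1.

Lemma lattice_cons_bij d : bijective (@lattice_cons d).
Proof.
exists (fun v : 'rV_(1 + d) => (rsubmx v, lsubmx v 0 0)).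
  by move=> [k m]; rewrite /lattice_cons /= row_mxKl row_mxKr mxE.
move=> v; rewrite /lattice_cons /= -[RHS](@hsubmxK _ 1 1 d); congr row_mx.
by apply/rowP => i; rewrite !mxE !ord1; congr (v _ _); apply/val_inj.
Qed.

Lemma chi_cons d (k : lattice d) m (s : R) (t : 'rV[R]_d) :
  chi (lattice_cons (k, m)) (row_mx (const_mx s : 'rV_1) t) =
  e1 (m%:~R * s) * chi k t.
Proof.
rewrite /chi -e1D; congr e1; rewrite /dotp (@big_split_ord _ _ _ 1 d) big_ord1 /=.
rewrite /lattice_cons.
rewrite !(@row_mxEl _ 1 1 d) !mxE; congr (_ + _); apply: eq_bigr => i _.
by rewrite !(@row_mxEr _ 1 1 d).
Qed.

Lemma l1_cons d (c : lattice d.+1 -> R[i]) :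
  (\esum_(k in setT) \esum_(m in setT) (normc (c (lattice_cons (k, m))))%:E = l1 c)%E.
Proof.
rewrite (l1_bij _ (lattice_cons_bij d)) /l1 /=.
rewrite (esum_pair (a := fun k m => (normc (c (lattice_cons (k, m))))%:E)).
  by apply: eq_esum => -[].
by move=> k m; rewrite lee_fin normc_ge0.
Qed.

Lemma l1_fiber d (c : lattice d.+1 -> R[i]) k : (l1 c < +oo)%E ->
  (l1 (fun m => c (lattice_cons (k, m))) < +oo)%E.
Proof.
rewrite -l1_cons; apply: le_lt_trans.
by apply: (@le_term_esum _ _ (fun k => l1 (fun m => c (lattice_cons (k, m))))) => ?;
  exact: l1_ge0.
Qed.

Lemma l1_slice d (c : lattice d.+1 -> R[i]) s :
  (l1 (fun k => symb1 (fun m => c (lattice_cons (k, m))) s) <= l1 c)%E.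
Proof.
rewrite -l1_cons; apply: le_esum => k _; apply: le_trans (csum_norm _) _.
by rewrite l1_Mchar// => m; exact: normc_e1.
Qed.

(** Drives induction on the dimension: once the first variable is frozen, the coefficients in the
    other variables are one-variable symbols. *)
Lemma symb_cons d (c : lattice d.+1 -> R[i]) s (t : 'rV[R]_d) : (l1 c < +oo)%E ->
  symb c (row_mx (const_mx s : 'rV_1) t) =
  symb (fun k => symb1 (fun m => c (lattice_cons (k, m))) s) t.
Proof.
move=> hc; rewrite /symb (csum_bij _ (lattice_cons_bij d)).
pose f k m : R[i] := chi k t * (c (lattice_cons (k, m)) * e1 (m%:~R * s)).
transitivity (csum setT (fun p => f p.1 p.2)).
  by congr csum; apply/funext => -[k m]; rewrite /f /= chi_cons; ring.
rewrite csum_pair.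
  congr csum; apply/funext => k; rewrite [RHS]mulrC.
  apply: csumZ; rewrite l1_Mchar; first exact: l1_fiber.
  by move=> m; exact: normc_e1.
rewrite -l1_cons in hc; apply: le_lt_trans hc.
apply: le_esum => k _; apply: le_esum => m _.
by rewrite /f !Normc.normcM normc_chi normc_e1 mul1r mulr1.
Qed.

Lemma lattice_cons0 d : lattice_cons (0, 0) = 0 :> lattice d.+1.
Proof.
rewrite /lattice_cons /=.
have -> : const_mx 0 = 0 :> 'rV[int]_1 by apply/rowP => i; rewrite !mxE.
exact: (@row_mx0 _ 1 1 d).
Qed.

Lemma symb_dim0 (c : lattice 0 -> R[i]) t : symb c t = c 0.
Proof.
rewrite /symb (csum_delta (i := 0)); last by move=> k; rewrite thinmx0 eqxx.
by rewrite chi0 mulr1.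
Qed.

Lemma cube_integral_symb d (c : lattice d -> R[i]) : (l1 c < +oo)%E ->
  cube_integral (fun t => complex.Re (symb c t)) = complex.Re (c 0).
Proof.
elim: d c => [|d IH] c hc.
  by rewrite -[LHS]/(complex.Re (symb c 0)) symb_dim0.
rewrite -[LHS]/(I01 (fun s => cube_integral (fun t : 'rV_d =>
  complex.Re (symb c (row_mx (const_mx s : 'rV_1) t))))) -lattice_cons0.
have <- := I01_symb1 (l1_fiber 0 hc); congr I01; apply/funext => s.
under [X in cube_integral X]eq_fun do rewrite symb_cons//.
by rewrite IH//; apply: le_lt_trans (l1_slice c s) hc.
Qed.

(** A mean is at most the maximum. Induction on the dimension, instead of comparing iterated
    integrals, leaves only integrals of continuous functions of one variable to compare. *)
Lemma Re_coef_le d (c : lattice d -> R[i]) b : (l1 c < +oo)%E ->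
  (forall t : 'rV[R]_d, (forall i, 0 <= t 0 i <= 1) -> complex.Re (symb c t) <= b) ->
  complex.Re (c 0) <= b.
Proof.
elim: d c => [|d IH] c hc hb.
  by have := hb 0; rewrite symb_dim0; apply=> -[].
rewrite -lattice_cons0 -(I01_symb1 (l1_fiber 0 hc)) -[leRHS]I01_cst.
apply: I01_le; first exact: (symb1_continuous (l1_fiber 0 hc)).
  by move=> x; exact: cvg_cst.
move=> s s01; apply: (IH (fun k => symb1 (fun m => c (lattice_cons (k, m))) s)).
  exact: le_lt_trans (l1_slice c s) hc.
move=> t t01; rewrite -symb_cons//; apply: hb => i.
by rewrite mxE; case: fintype.split => j; rewrite ?mxE.
Qed.

Lemma symb_shift d (c : lattice d -> R[i]) k t : (l1 c < +oo)%E ->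
  symb c t * chi (- k) t = symb (fun l => c (l + k)) t.
Proof.
move=> hc; rewrite mulrC /symb -csumZ; last first.
  by rewrite l1_Mchar// => l; exact: normc_chi.
have bk : bijective (fun l : lattice d => l + k).
  by exists (fun l => l - k) => l; rewrite ?addrK ?subrK.
rewrite (csum_bij _ bk); congr csum; apply/funext => l /=.
by rewrite chiD mulrCA [chi l t * _]mulrC [_ * (_ * chi l t)]mulrA chiNV mul1r.
Qed.

Lemma l1_shift d (c : lattice d -> R[i]) k : l1 (fun l => c (l + k)) = l1 c.
Proof.
rewrite [RHS](@l1_bij _ _ _ (fun l => l + k))//.
by exists (fun l => l - k) => l; rewrite ?addrK ?subrK.
Qed.

(** Multiplying by the character of [- k] moves the coefficient of index [k] to index 0, where it is
    the mean of the symbol. *)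
Lemma fourier_symb d (u : 'rV[R[i]]_d -> R[i]) (a : lattice d -> R[i]) :
  (l1 a < +oo)%E -> (forall t, u (torus_point t) = symb a t) ->
  forall k, fourier u k = a k.
Proof.
move=> ha hu k; rewrite /fourier.
have vE t : u (torus_point t) * monom (- k) (torus_point t) =
    symb (fun l => a (l + k)) t.
  by rewrite hu monomE symb_shift.
rewrite -[a k]ComplexReIm; congr Complex.
  under eq_fun do rewrite vE.
  by rewrite cube_integral_symb ?l1_shift// add0r.
have hai : (l1 (fun l => (- 'i%C) * a (l + k))%R < +oo)%E.
  by rewrite l1Z_fin// l1_shift.
under eq_fun do rewrite vE.
(* The imaginary part is reduced to the real one by rotating the coefficients by [- 'i]. *)
have ImE z : complex.Im z = complex.Re (- 'i%C * z) :> R.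
  by case: z => x y /=; ring.
rewrite [RHS]ImE -[k in RHS]add0r -(cube_integral_symb hai).
congr cube_integral; apply/funext => t; rewrite ImE; congr complex.Re.
rewrite /symb -csumZ; last by rewrite l1_Mchar ?l1_shift// => l; exact: normc_chi.
by congr csum; apply/funext => l; rewrite mulrA.
Qed.

(** After a shift by [k] and multiplication by the conjugate of [a k], the coefficient at 0 is
    [|a k| ^ 2], so the bound on real parts gives [|a k| ^ 2 <= |a k| * b]. *)
Lemma coef_le d (a : lattice d -> R[i]) b : (l1 a < +oo)%E ->
  (forall t : 'rV[R]_d, (forall i, 0 <= t 0 i <= 1) -> normc (symb a t) <= b) ->
  forall k, normc (a k) <= b.
Proof.
move=> ha hb k.
have [->|a0] := eqVneq (normc (a k)) 0.
  by apply: le_trans (hb 0 _); rewrite ?normc_ge0// => i; rewrite mxE lexx ler01.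
have ap : 0 < normc (a k) by rewrite lt_neqAle eq_sym a0 normc_ge0.
rewrite -(ler_pM2l ap) -expr2 -Re_conjM.
have hc : (l1 (fun l => (a k)^*%C * a (l + k))%R < +oo)%E.
  by rewrite l1Z_fin// l1_shift.
have := @Re_coef_le _ _ (normc (a k) * b) hc; rewrite add0r; apply => t t01.
apply: le_trans (ler_norm _) _; apply: le_trans (normr_Re_le _) _.
have -> : symb (fun l => (a k)^*%C * a (l + k)) t =
    (a k)^*%C * (symb a t * chi (- k) t).
  rewrite symb_shift// /symb -csumZ; last by rewrite l1_Mchar ?l1_shift// => l; exact: normc_chi.
  by congr csum; apply/funext => l; rewrite mulrA.
by rewrite !Normc.normcM normc_conj normc_chi mulr1 ler_pM2l// hb.
Qed.

End FourierCoefficients.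


(** * The Wiener algebra *)

Section Convolution.
Variables (R : realType) (d : nat).
Implicit Types a b : lattice d -> R[i].

Definition convol a b (m : lattice d) : R[i] := csum setT (fun l => a (m - l) * b l).

Lemma bij_translation (l : lattice d) : bijective (fun m : lattice d => m - l).
Proof. by exists (fun m => m + l) => m; rewrite ?addrK ?subrK. Qed.

Lemma esum_convol a b :
  (\esum_(m in setT) \esum_(l in setT) (normc (a (m - l) * b l))%:E =
   \esum_(l in setT) ((normc (b l))%:E * l1 a))%E.
Proof.
rewrite esum_swap => [|m l]; last by rewrite lee_fin normc_ge0.
apply: eq_esum => l _; rewrite (l1_bij _ (bij_translation l)) -l1Z.
by apply: eq_esum => m _ /=; rewrite mulrC.
Qed.

Lemma esum_convol_le a b (A B : R) : (l1 a <= A%:E)%E -> (l1 b <= B%:E)%E ->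
  (\esum_(m in setT) \esum_(l in setT) (normc (a (m - l) * b l))%:E <= (A * B)%:E)%E.
Proof.
move=> hA hB; rewrite esum_convol.
have fa : l1 a = (fine (l1 a))%:E.
  by rewrite fineK// ge0_fin_numE ?l1_ge0//; apply: le_lt_trans hA _; rewrite ltry.
rewrite fa; under eq_esum do rewrite muleC.
rewrite esumZl ?fine_ge0 ?l1_ge0// => [|l]; last by rewrite lee_fin normc_ge0.
by rewrite -fa EFinM lee_pmul ?l1_ge0.
Qed.

Lemma l1_convol a b (A B : R) : (l1 a <= A%:E)%E -> (l1 b <= B%:E)%E ->
  (l1 (convol a b) <= (A * B)%:E)%E.
Proof.
move=> hA hB; apply: le_trans (esum_convol_le hA hB).
by apply: le_esum => m _; exact: csum_norm.
Qed.

Lemma l1_fin_le a : (l1 a < +oo)%E -> (l1 a <= (fine (l1 a))%:E)%E.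
Proof. by move=> ha; rewrite fineK// ge0_fin_numE ?l1_ge0. Qed.

Lemma symb_convol a b t : (l1 a < +oo)%E -> (l1 b < +oo)%E ->
  symb (convol a b) t = symb a t * symb b t.
Proof.
move=> ha hb; rewrite [RHS]mulrC.
have hat : (l1 (fun m => a m * chi m t)%R < +oo)%E.
  by rewrite l1_Mchar// => m; exact: normc_chi.
have hbt : (l1 (fun m => b m * chi m t)%R < +oo)%E.
  by rewrite l1_Mchar// => m; exact: normc_chi.
have fin0 := le_lt_trans (esum_convol_le (l1_fin_le ha) (l1_fin_le hb)) (ltry _).
have fin : (\esum_(m in setT) \esum_(l in setT)
    (normc (chi m t * (a (m - l) * b l)))%:E < +oo)%E.
  apply: le_lt_trans fin0.
  apply: le_esum => m _; apply: le_esum => l _.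
  by rewrite Normc.normcM normc_chi mul1r.
have hrow m : (l1 (fun l => a (m - l) * b l)%R < +oo)%E.
  apply: le_lt_trans fin0.
  apply: (@le_term_esum _ _ (fun m => l1 (fun l => a (m - l) * b l))) => i.
  exact: l1_ge0.
transitivity (csum setT (fun m => csum setT (fun l => chi m t * (a (m - l) * b l)))).
  rewrite /symb; congr csum; apply/funext => m; rewrite [LHS]mulrC.
  by rewrite -(csumZ _ (hrow m)).
rewrite (csum_swap fin).
transitivity (csum setT (fun l => symb a t * (b l * chi l t))); last first.
  by rewrite (csumZ _ hbt) mulrC.
congr csum; apply/funext => l.
rewrite [RHS]mulrC -(csumZ _ hat) [RHS](csum_bij _ (bij_translation l)).
congr csum; apply/funext => m /=.
have -> : chi m t = chi (m - l) t * chi l t by rewrite -chiD subrK.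
by rewrite mulrC [chi (m - l) t * _]mulrC [a _ * b l]mulrC mulrACA.
Qed.

Lemma convol_supp (S1 S2 S3 : set (lattice d)) a b :
  (forall k, ~ S1 k -> a k = 0) -> (forall k, ~ S2 k -> b k = 0) ->
  (forall k l, S1 k -> S2 l -> S3 (k + l)) ->
  forall k, ~ S3 k -> convol a b k = 0.
Proof.
move=> ha hb hS k kS; rewrite /convol -[RHS](csum0 R (lattice d)); congr csum.
apply/funext => l; have [lS|lS] := pselect (S2 l); last by rewrite hb// mulr0.
rewrite ha ?mul0r// => klS; apply: kS.
by rewrite -(subrK l k); exact: hS.
Qed.

End Convolution.

(** * Closure properties of the Wiener algebra with supports *)

Section WienerClass.
Variables (R : realType) (d : nat).
Implicit Types (S : set (lattice d)) (u v : 'rV[R]_d -> R[i]).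

(* [wien S u B]: [u] is the symbol of a family supported in [S], of l1 norm at
   most [B].  Functions on the torus are composed with [torus_point], the only
   points at which [fourier] evaluates its argument. *)
Definition wien S u (B : R) := exists a : lattice d -> R[i],
  [/\ forall k, ~ S k -> a k = 0, (l1 a <= B%:E)%E & forall t, u t = symb a t].

Lemma wien_fin S u B : wien S u B -> exists a : lattice d -> R[i],
  [/\ forall k, ~ S k -> a k = 0, (l1 a < +oo)%E & forall t, u t = symb a t].
Proof. by move=> [a [aS aB au]]; exists a; split => //; exact: le_lt_trans aB (ltry _). Qed.

Lemma wien_ge0 S u B : wien S u B -> 0 <= B.
Proof. by move=> [a [_ aB _]]; rewrite -lee_fin; apply: le_trans (l1_ge0 a) aB. Qed.

Lemma wien_le S S' u B B' : S `<=` S' -> B <= B' -> wien S u B -> wien S' u B'.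
Proof.
move=> SS BB [a [aS aB au]]; exists a; split => //.
  by move=> k kS; apply: aS => /SS.
by apply: le_trans aB _; rewrite lee_fin.
Qed.

Lemma wien_norm S u B t : wien S u B -> normc (u t) <= B.
Proof.
move=> [a [_ aB ->]]; rewrite -lee_fin; apply: le_trans aB.
by apply: le_trans (csum_norm _) _; rewrite l1_Mchar// => k; exact: normc_chi.
Qed.

Lemma symbD (a b : lattice d -> R[i]) t : (l1 a < +oo)%E -> (l1 b < +oo)%E ->
  symb (fun k => a k + b k) t = symb a t + symb b t.
Proof.
move=> ha hb; rewrite /symb -csumD.
- by congr csum; apply/funext => k; rewrite mulrDl.
- by rewrite l1_Mchar// => k; exact: normc_chi.
- by rewrite l1_Mchar// => k; exact: normc_chi.
Qed.

Lemma symbZ z (a : lattice d -> R[i]) t : (l1 a < +oo)%E ->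
  symb (fun k => z * a k) t = z * symb a t.
Proof.
move=> ha; rewrite /symb -csumZ.
- by congr csum; apply/funext => k; rewrite mulrA.
- by rewrite l1_Mchar// => k; exact: normc_chi.
Qed.

Lemma wienD S u v A B : wien S u A -> wien S v B ->
  wien S (fun t => u t + v t) (A + B).
Proof.
move=> [a [aS aB au]] [b [bS bB bv]]; exists (fun k => a k + b k); split.
- by move=> k kS; rewrite aS// bS// addr0.
- by apply: le_trans (l1D a b) _; rewrite EFinD leeD.
- move=> t; rewrite symbD ?au ?bv//.
    exact: le_lt_trans aB (ltry _).
  exact: le_lt_trans bB (ltry _).
Qed.

Lemma wienZ S z u A : wien S u A -> wien S (fun t => z * u t) (normc z * A).
Proof.
move=> [a [aS aB au]]; exists (fun k => z * a k); split.
- by move=> k kS; rewrite aS// mulr0.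
- by rewrite l1Z EFinM lee_pmul ?l1_ge0// lee_fin normc_ge0.
- by move=> t; rewrite symbZ ?au//; exact: le_lt_trans aB (ltry _).
Qed.

Lemma wienM S1 S2 S3 u v A B : (forall k l, S1 k -> S2 l -> S3 (k + l)) ->
  wien S1 u A -> wien S2 v B -> wien S3 (fun t => u t * v t) (A * B).
Proof.
move=> hS [a [aS aB au]] [b [bS bB bv]]; exists (convol a b); split.
- exact: convol_supp aS bS hS.
- exact: l1_convol.
- move=> t; rewrite symb_convol ?au ?bv//.
    exact: le_lt_trans aB (ltry _).
  exact: le_lt_trans bB (ltry _).
Qed.

Lemma wien_cst S z : S 0 -> wien S (fun=> z) (normc z).
Proof.
move=> S0; exists (fun k => if k == 0 then z else 0); split.
- by move=> k kS; case: eqP => // k0; rewrite k0 in kS.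
- have := l1_finsupp_le [:: (0 : lattice d)] (fun=> z).
  rewrite big_seq1; under eq_fun do rewrite inE; exact.
- move=> t; rewrite /symb (csum_delta (i := 0)) ?eqxx ?chi0 ?mulr1// => k /negPf ->.
  by rewrite mul0r.
Qed.

Lemma wien_csum (I : choiceType) S (u : I -> 'rV[R]_d -> R[i]) (B : I -> R) (C : R) :
  (forall i, wien S (u i) (B i)) -> (\esum_(i in setT) (B i)%:E <= C%:E)%E ->
  wien S (fun t => csum setT (fun i => u i t)) C.
Proof.
move=> hu hB; have [a ha] := choice hu.
have tot : (\esum_(i in setT) \esum_(k in setT) (normc (a i k))%:E <= C%:E)%E.
  by apply: le_trans hB; apply: le_esum => i _; have [] := ha i.
exists (fun k => csum setT (fun i => a i k)); split.
- move=> k kS; rewrite -[RHS](csum0 R I); congr csum; apply/funext => i.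
  by have [+ _ _] := ha i; exact.
- apply: le_trans tot; rewrite [leRHS]esum_swap => [|i k]; last by rewrite lee_fin normc_ge0.
  by apply: le_esum => k _; exact: csum_norm.
move=> t; rewrite /symb.
have fin : (\esum_(i in setT) \esum_(k in setT) (normc (a i k * chi k t))%:E < +oo)%E.
  apply: le_lt_trans (ltry C); apply: le_trans tot.
  apply: le_esum => i _; apply: le_esum => k _.
  by rewrite Normc.normcM normc_chi mulr1.
transitivity (csum setT (fun i => csum setT (fun k => a i k * chi k t))).
  by congr csum; apply/funext => i; have [_ _ ->] := ha i.
rewrite (csum_swap fin); congr csum; apply/funext => k.
rewrite [RHS]mulrC -csumZ; first by congr csum; apply/funext => i; rewrite mulrC.
apply: le_lt_trans (ltry C); apply: le_trans tot.
apply: le_esum => i _.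
by apply: (@le_term_esum _ _ (fun k => (normc (a i k))%:E)) => k'; rewrite lee_fin normc_ge0.
Qed.

Lemma wienX S u A n : S 0 -> (forall k l, S k -> S l -> S (k + l)) ->
  wien S u A -> wien S (fun t => u t ^+ n) (A ^+ n).
Proof.
move=> S0 SD hu; elim: n => [|n IH].
  have := wien_cst 1 S0; rewrite Normc.normc1 expr0.
  by congr wien; apply/funext => t; rewrite expr0.
rewrite exprS; under eq_fun do rewrite exprS.
exact: wienM hu IH.
Qed.

(** Powers of a family supported in an additive monoid keep that support, hence so does the
    exponential series. This confines [omega_plus] and its inverse to the half-lattice. *)
Lemma wien_cexp S u A : S 0 -> (forall k l, S k -> S l -> S (k + l)) ->
  wien S u A -> wien S (fun t => cexp (u t)) (expR A).
Proof.
move=> S0 SD hu.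
have -> : (fun t => cexp (u t)) = (fun t => csum setT (fun n => expc_coeff (u t) n)).
  by apply/funext => t; rewrite -csum_expc.
apply: (wien_csum (B := exp_coeff A)).
  move=> n; rewrite /expc_coeff; under eq_fun do rewrite mulrC.
  have -> : exp_coeff A n = normc (n`!%:R^-1)%:C * A ^+ n.
    by rewrite normcR normfV normr_nat mulrC.
  by apply: wienZ; exact: wienX.
have A0 := wien_ge0 hu.
rewrite -{2}(ger0_norm A0); apply: le_trans (asum_expR A).
by apply: le_esum => n _; rewrite lee_fin ler_norm.
Qed.

End WienerClass.


(** * The Wiener-Levy theorem for the logarithm *)

Section BoxedSymbols.
Variables (R : realType) (d : nat).

Definition box (N : nat) : set (lattice d) := [set k | forall i, `|k 0 i| <= N%:Z].

(** Entries range over ['I_(2N+1)] shifted by [N], that is, over the integers from [- N] to [N], so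
    that the length is immediate. *)
Definition box_enum (N : nat) : seq (lattice d) :=
  [seq map_mx (fun i : 'I_N.*2.+1 => i%:Z - N%:Z) x | x : 'rV['I_N.*2.+1]_d].

Lemma size_box_enum N : size (box_enum N) = (N.*2.+1 ^ d)%N.
Proof. by rewrite size_map -cardE card_mx card_ord mul1n. Qed.

Lemma mem_box_enum N k : box N k -> k \in box_enum N.
Proof.
move=> kN; apply/mapP.
exists (map_mx (fun z : int => inord (absz (z + N%:Z))) k); first by rewrite mem_enum.
apply/rowP => i; rewrite !mxE inordK.
  have := kN i; rewrite ler_norml => /andP[h _].
  by rewrite gez0_abs ?addrK// -lerBlDr sub0r.
by have := kN i; lia.
Qed.

Lemma boxD N M k l : box N k -> box M l -> box (N + M) (k + l).
Proof.
move=> kN lM i; rewrite mxE PoszD; apply: le_trans (ler_normD _ _) _.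
by rewrite lerD.
Qed.

(** Partial converse of [wien_norm]: each coefficient is at most the sup over the cube, and the box
    has at most [(2N+1)^d] points. The new bound no longer involves [B]. *)
Lemma wien_box N (u : 'rV[R]_d -> R[i]) B s : wien (box N) u B ->
  (forall t : 'rV[R]_d, (forall i, 0 <= t 0 i <= 1) -> normc (u t) <= s) ->
  wien setT u ((N.*2.+1 ^ d)%:R * s).
Proof.
move=> /wien_fin[a [aN ha au]] us; exists a.
have has k : normc (a k) <= s.
  by apply: (coef_le ha) => t t01; rewrite -au us.
have aE : a = (fun k => if k \in box_enum N then a k else 0).
  apply/funext => k; case: ifPn => // kE; apply: aN => /mem_box_enum.
  by apply/negP.
split=> [k /(_ I)//||//]; rewrite aE.
apply: le_trans (l1_finsupp_le _ _) _; rewrite lee_fin.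
apply: (@le_trans _ _ (\sum_(k <- box_enum N) s)); first exact: ler_sum.
by rewrite big_const_seq count_predT iter_addr_0 size_box_enum mulr_natl.
Qed.

Lemma wien_boxX N (u : 'rV[R]_d -> R[i]) B n : wien (box N) u B ->
  wien (box (N * n)) (fun t => u t ^+ n) (B ^+ n).
Proof.
move=> hu; elim: n => [|n IH].
  have := @wien_cst R d (box (N * 0)) 1; rewrite Normc.normc1 expr0 => h.
  have -> : (fun t => u t ^+ 0) = fun=> 1 by apply/funext => t; rewrite expr0.
  by apply: h => i; rewrite mxE normr0.
rewrite exprS; under eq_fun do rewrite exprS.
apply: wienM hu IH => k l kN lN; rewrite mulnS; exact: boxD.
Qed.

Lemma finite_in_box (s : seq (lattice d)) : exists N, forall k, k \in s -> box N k.
Proof.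
elim: s => [|k s [N hN]]; first by exists 0%N.
exists (N + \max_(i < d) absz (k 0%R i))%N => l; rewrite inE => /predU1P[->|/hN lN] i.
  rewrite -abszE lez_nat; apply: leq_trans (leq_addl _ _).
  exact: (@leq_bigmax _ (fun i => absz (k 0 i))).
by apply: le_trans (lN i) _; rewrite lez_nat leq_addr.
Qed.

Lemma dotp_continuous (k : lattice d) : continuous (dotp (R := R) k).
Proof.
apply: (@continuous_bigsum R _ _ _ (fun i (t : 'rV[R]_d) => (k 0 i)%:~R * t 0 i)) => i t.
have h := @coord_continuous R 1 d 0 i t.
exact: (cvgMr h).
Qed.

Lemma Re_symb_continuous (a : lattice d -> R[i]) : (l1 a < +oo)%E ->
  continuous (fun t : 'rV[R]_d => complex.Re (symb a t)).
Proof.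
move=> ha; apply: (@Re_csum_continuous R _ _ a (fun k t => chi k t)) => //.
  by move=> k t; rewrite normc_chi.
move=> k z t.
have h := @continuous_Re_Me1 R 1 z (dotp k t).
have := continuous_comp (@dotp_continuous k t) h.
by rewrite (_ : _ \o _ = fun t => complex.Re (z * chi k t))//;
  apply/funext => x; rewrite /= mul1r.
Qed.

Definition cube : set 'rV[R]_d := [set t | forall i, 0 <= t 0 i <= 1].

Lemma cube_compact : compact cube.
Proof.
have := @rV_compact R d (fun=> `[0%R, 1%R]%classic) (fun=> @segment_compact R 0 1).
by congr compact; apply/seteqP; split => t /= h i; have := h i; rewrite /= in_itv.
Qed.

(** Compactness makes positivity uniform; this minimum is what later keeps [q] below 1. *)
Lemma symb_min (a : lattice d -> R[i]) : (l1 a < +oo)%E ->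
  (forall t, 0 < complex.Re (symb a t)) ->
  exists2 m, 0 < m & forall t, cube t -> m <= complex.Re (symb a t).
Proof.
move=> ha hpos.
have c0 : cube !=set0 by exists 0 => i; rewrite mxE lexx ler01.
have cf : {within cube, continuous (fun t : 'rV[R]_d => complex.Re (symb a t))}.
  exact: (continuous_subspaceT (Re_symb_continuous ha)).
have [c _ hc] := EVT_min_rV c0 cube_compact cf.
exists (complex.Re (symb a c)) => // t ct; apply: hc; exact: mem_set.
Qed.

End BoxedSymbols.


(** * Power bounds in l1 and the logarithm *)

Section WienerLevy.
Variables (R : realType) (d : nat).

Lemma wien_symb (a : lattice d -> R[i]) B : (l1 a <= B%:E)%E ->
  wien setT (symb a) B.
Proof. by move=> aB; exists a; split => // k /(_ I). Qed.

(* Split [b = p + r] with [p] finitely supported and [r] of l1 norm at most [e].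
   The coefficients of [p ^ m] are at most [sup |p| ^ m] and lie in a box of
   polynomial cardinality, so the norm of [p ^ m] grows like [sup |p| ^ m] up to
   a polynomial factor; the induction on [j] then replaces factors [p] by [b]. *)
Lemma wien_power_bound (b : lattice d -> R[i]) (q : R) : (l1 b < +oo)%E ->
  0 <= q < 1 ->
  (forall t : 'rV[R]_d, cube t -> normc (symb b t) <= q) ->
  exists N : nat, forall n,
    wien setT (fun t : 'rV[R]_d => symb b t ^+ n)
      (((N * n).*2.+1 ^ d)%:R * ((1 + q) / 2) ^+ n).
Proof.
(* Chosen so that [q + 2e = (1 + q) / 2]: one [e] for passing from [b] to [p] in the sup norm, one
   for the l1 norm of [r]. *)
move=> hb /andP[q0 q1] bq; pose e := (1 - q) / 4.
have e0 : 0 < e by rewrite /e; lra.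
have [s us hs] := l1_tail hb e0.
pose p := symb (fun k => if k \in s then b k else 0).
pose r := symb (fun k => if k \in s then 0 else b k).
have hr : wien setT r e by exact: wien_symb.
have hps := l1_finsupp s b.
have upr t : symb b t = p t + r t.
  rewrite /p /r -symbD//; last exact: le_lt_trans hs (ltry _).
  congr (symb _ t); apply/funext => k.
  by case: (k \in s); rewrite ?addr0 ?add0r.
have [N hN] := finite_in_box s.
have hp : wien (box N) p (\sum_(k <- s) normc (b k)).
  exists (fun k => if k \in s then b k else 0); split=> //; last exact: l1_finsupp_le.
  by move=> k kN; case: ifP => // /hN.
have ps t : cube t -> normc (p t) <= q + e.
  move=> ct; have -> : p t = symb b t + (- r t) by rewrite upr addrK.
  apply: le_trans (le_normcD _ _) _; rewrite normcN.
  by apply: lerD; [exact: bq|exact: wien_norm hr].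
exists N => n; pose D : R := ((N * n).*2.+1 ^ d)%:R; rewrite -/D.
have D0 : 0 <= D by rewrite ler0n.
(* Expanding one factor [symb b] as [p + r] yields the ratios [q + e] and [e], which add up to
   [q + e + e]. Since [m <= n], the single count [D] dominates all boxes met on the way. *)
have claim j m : (m + j <= n)%N ->
    wien setT (fun t : 'rV[R]_d => p t ^+ m * symb b t ^+ j)
      (D * (q + e) ^+ m * (q + e + e) ^+ j).
  elim: j m => [|j IH] m mn.
    have := @wien_box R d (N * m) _ _ ((q + e) ^+ m) (wien_boxX m hp).
    have -> : (fun t => p t ^+ m * symb b t ^+ 0) = (fun t => p t ^+ m).
      by apply/funext => t; rewrite expr0 mulr1.
    rewrite expr0 mulr1 => h; apply: wien_le (h _) => //.
      rewrite ler_wpM2r ?exprn_ge0 ?addr_ge0 ?(ltW e0)//.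
      rewrite /D !natrX lerXn2r ?nnegrE ?ler0n// ler_nat ltnS leq_double.
      by rewrite leq_mul2l (leq_trans _ mn) ?orbT// leq_addr.
    by move=> t ct; rewrite normcX lerXn2r ?nnegrE ?normc_ge0 ?addr_ge0 ?(ltW e0)// ps.
  have h1 : wien setT (fun t => p t ^+ m.+1 * symb b t ^+ j) _ := IH m.+1 ltac:(lia).
  have h2 : wien setT (fun t => r t * (p t ^+ m * symb b t ^+ j)) _ :=
    wienM (fun k l _ _ => I) hr (IH m ltac:(lia)).
  have := wienD h1 h2.
  have -> : (fun t => p t ^+ m.+1 * symb b t ^+ j + r t * (p t ^+ m * symb b t ^+ j)) =
      (fun t => p t ^+ m * symb b t ^+ j.+1).
    by apply/funext => t; rewrite [symb b t ^+ j.+1]exprS {3}upr exprS; ring.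
  by congr wien; rewrite !exprS; ring.
have := claim n 0%N (leqnn n).
rewrite expr0 mulr1; have -> : q + e + e = (1 + q) / 2 by rewrite /e; field.
by congr wien; apply/funext => t; rewrite expr0 mul1r.
Qed.

Lemma poly_exp_bound (N : nat) (S : R) : 0 < S < 1 -> exists K rho : R,
  [/\ 0 <= K, 0 < rho < 1 &
   forall n, ((N * n).*2.+1 ^ d)%:R * S ^+ n <= K * rho ^+ n].
Proof.
move=> /andP[S0 S1]; pose rho := (1 + S) / 2.
have r0 : 0 < rho by rewrite /rho; lra.
have r1 : rho < 1 by rewrite /rho; lra.
have rS : 1 < rho / S by rewrite ltr_pdivlMr// mul1r /rho; lra.
(* The rate at which the d-th power of [expR (eta * n)] stays below [(rho / S) ^ n]; dividing by
   [d + 1] also covers dimension 0. *)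
pose eta := ln (rho / S) / d.+1%:R.
have eta0 : 0 < eta by rewrite divr_gt0// ln_gt0.
(* Makes [2 N n + 1 <= C * (1 + eta * n)], after which [1 + x <= expR x] applies. *)
pose C := 1 + 2 * N%:R / eta.
have hC : 0 <= 2 * N%:R / eta.
  by apply: divr_ge0; [rewrite mulr_ge0 ?ler0n|exact: ltW].
have C0 : 1 <= C by rewrite /C lerDl.
exists (C ^+ d), rho; split; rewrite ?r0//.
  by rewrite exprn_ge0// (le_trans ler01 C0).
move=> n.
have -> : rho ^+ n = (rho / S) ^+ n * S ^+ n by rewrite -exprMn divfK// gt_eqF.
rewrite mulrA ler_wpM2r ?exprn_ge0 ?(ltW S0)//.
have h1 : ((N * n).*2.+1)%:R <= C * expR (eta * n%:R).
  apply: (@le_trans _ _ (C * (1 + eta * n%:R))); last first.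
    by rewrite ler_wpM2l ?expR_ge1Dx// (le_trans ler01 C0).
  rewrite -muln2 -addn1 natrD !natrM.
  have -> : C * (1 + eta * n%:R) = 1 + 2 * N%:R / eta + eta * n%:R + 2 * N%:R * n%:R.
    by rewrite /C; field; rewrite gt_eqF.
  have : 0 <= eta * n%:R by rewrite mulr_ge0 ?ler0n// ltW.
  by move: hC; lra.
rewrite natrX.
apply: (@le_trans _ _ ((C * expR (eta * n%:R)) ^+ d)).
  by rewrite lerXn2r ?nnegrE ?ler0n// (le_trans _ h1).
rewrite exprMn ler_wpM2l ?exprn_ge0 ?(le_trans ler01 C0)//.
rewrite -[rho / S]lnK ?posrE ?(lt_trans ltr01)// -!expRM_natl ler_expR.
have -> : ln (rho / S) = eta * d.+1%:R by rewrite /eta divfK// pnatr_eq0.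
have : 0 <= eta * n%:R by rewrite mulr_ge0 ?ler0n// ltW.
by rewrite -natr1; lra.
Qed.

Lemma esum_geometric (K rho : R) : 0 <= K -> 0 < rho < 1 ->
  (\esum_(n in setT) (K * rho ^+ n)%:E <= (K / (1 - rho))%:E)%E.
Proof.
move=> K0 /andP[r0 r1].
have -> : (\esum_(n in setT) (K * rho ^+ n)%:E)%E = asum (fun n => K * rho ^+ n).
  by apply: eq_esum => n _; rewrite ger0_norm// mulr_ge0// exprn_ge0// ltW.
apply: series_asum => n.
under eq_bigr do rewrite ger0_norm ?mulr_ge0 ?exprn_ge0 ?(ltW r0)//.
rewrite -mulr_sumr ler_wpM2l// -[leRHS]mul1r ler_pdivlMr ?subr_gt0// big_mkord.
have := subrX1 rho n; have : 0 <= rho ^+ n by rewrite exprn_ge0// ltW.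
set x := \sum_(i < n) _; lra.
Qed.

Lemma wiener_log (a : lattice d -> R[i]) : (l1 a < +oo)%E ->
  (forall t : 'rV[R]_d, 0 < symb a t) ->
  exists B, wien setT (fun t : 'rV[R]_d => (ln (complex.Re (symb a t)))%:C) B.
Proof.
move=> ha apos; pose f t := complex.Re (symb a t).
have fE t : symb a t = (f t)%:C.
  by have := apos t; rewrite ltcE /f; case: (symb a t) => x y /= /andP[/eqP -> _].
have f0 t : 0 < f t by have := apos t; rewrite fE ltcR.
have [m m0 fm] := symb_min ha f0.
(* The l1 norm dominates the symbol, so [u = 1 - f / M] lies in [[0, 1)] everywhere and below
   [1 - m / M] on the cube. *)
pose M := fine (l1 a).
have wa : wien setT (symb a) M by apply: wien_symb; exact: l1_fin_le.
have fM t : f t <= M.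
  by apply: le_trans (ler_norm _) (le_trans (normr_Re_le _) _); exact: wien_norm wa.
have M0 : 0 < M by exact: lt_le_trans (f0 0) (fM 0).
pose u t : R[i] := (1 - f t / M)%:C.
have [B wu] : exists B, wien setT u B.
  eexists; have -> : u = (fun t => 1 + (- (M^-1)%:C) * symb a t).
    by apply/funext => t; rewrite /u fE mulNr rmorphB rmorph1 mulrC rmorphM.
  apply: wienD; first exact: wien_cst.
  exact: wienZ wa.
have [b [_ hb ub]] := wien_fin wu.
have m1 : m <= M.
  by apply: le_trans (fM 0); apply: fm => i; rewrite mxE lexx ler01.
have u01 t : 0 <= 1 - f t / M < 1.
  rewrite subr_ge0 ler_pdivrMr// mul1r fM ltrBlDr ltrDl divr_gt0//.
have [||N hN] := @wien_power_bound b (1 - m / M) hb.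
- by rewrite subr_ge0 ler_pdivrMr// mul1r m1 ltrBlDr ltrDl divr_gt0.
- move=> t ct; rewrite -ub normcR; have /andP[h _] := u01 t.
  by rewrite ger0_norm// lerD2l lerN2 ler_pM2r ?invr_gt0// fm.
have [|K [rho [K0 r01 hK]]] := @poly_exp_bound N ((1 + (1 - m / M)) / 2).
  have : m / M <= 1 by rewrite ler_pdivrMr// mul1r.
  have : 0 < m / M by rewrite divr_gt0.
  by set x := m / M => x0 x1; apply/andP; split; lra.
have /andP[r0 r1] := r01.
(* The factor [1 / (n + 1)] and the extra [rho] are both bounded by 1, leaving a plain geometric
   series. *)
have wn n : wien setT (fun t => u t ^+ n.+1 * (n.+1%:R^-1)%:C) (K * rho ^+ n).
  have -> : (fun t => u t ^+ n.+1 * (n.+1%:R^-1)%:C) =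
      (fun t => (n.+1%:R^-1)%:C * symb b t ^+ n.+1).
    by apply/funext => t; rewrite ub mulrC.
  apply: wien_le (wienZ _ (hN n.+1)) => //.
  rewrite normcR normfV normr_nat.
  apply: (@le_trans _ _ (1 * (K * rho ^+ n.+1))).
    apply: ler_pM => //; rewrite ?invr_ge0 ?ler0n//; last by rewrite invf_le1// ler1n.
    exact: wien_ge0 (hN n.+1).
  by rewrite mul1r ler_wpM2l// exprS ler_piMl ?(ltW r1)// exprn_ge0// ltW.
have wlog := wien_csum wn (esum_geometric K0 r01).
(* [ln f = ln M + ln (1 - u)], and the series sums to [- ln (1 - u)]. *)
have := wienD (wien_cst (ln M)%:C (I : setT 0)) (wienZ (-1) wlog).
set C := (X in wien _ _ X) => h; exists C; move: h.
congr wien; apply/funext => t.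
have -> : csum setT (fun n => u t ^+ n.+1 * (n.+1%:R^-1)%:C) = (- ln (f t / M))%:C.
  have -> : (fun n => u t ^+ n.+1 * (n.+1%:R^-1)%:C) =
      (fun n => (ln_coeff (1 - f t / M) n)%:C).
    by apply/funext => n; rewrite /ln_coeff rmorphM rmorphXn.
  rewrite /csum /= rsum_ln ?u01// opprB addrCA subrr addr0.
  by have := csum0 R nat; rewrite /csum /= => -[->].
rewrite ln_div ?posrE// mulN1r -rmorphN -rmorphD /= -/(f t); congr (_%:C).
by ring.
Qed.

End WienerLevy.


(** * Schur's test *)

Section WeightedPowerMean.
Variable R : realType.

(** Young's inequality with second factor 1; [r = 1] is separate because its conjugate exponent is
    infinite. *)
Lemma powR_tangent (r y : R) : 1 <= r -> 0 <= y -> y <= y `^ r / r + (1 - r^-1).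
Proof.
rewrite le_eqVlt => /predU1P[<-|r1] y0.
  by rewrite invr1 powRr1// mulr1 subrr addr0.
have r0 : 0 < r by exact: lt_trans r1.
have rB : 0 < r - 1 by rewrite subr_gt0.
have qE : (r / (r - 1))^-1 = 1 - r^-1.
  by rewrite invfM invrK; field; rewrite !gt_eqF.
have := @conjugate_powR R y 1 r (r / (r - 1)) y0 ler01 r0.
rewrite divr_gt0// qE subrKC => /(_ isT erefl).
by rewrite mulr1 powR1 mul1r.
Qed.

(* Weighted power mean inequality: sum the tangent inequality at the scale [t]
   with [t ^ r = Q / K]. *)
Lemma weighted_esum_le (I : choiceType) (r K Q : R) (w x : I -> R) :
  1 <= r -> 0 < K -> 0 <= Q -> (forall i, 0 <= w i) -> (forall i, 0 <= x i) ->
  (\esum_(i in setT) (w i)%:E <= K%:E)%E ->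
  (\esum_(i in setT) (w i * x i `^ r)%:E <= Q%:E)%E ->
  (\esum_(i in setT) (w i * x i)%:E <= (K * (Q / K) `^ r^-1)%:E)%E.
Proof.
move=> r1 K0 Q0 w0 x0 hK hQ; have r0 : 0 < r by exact: lt_le_trans r1.
have wx0 i : 0 <= w i * x i `^ r by rewrite mulr_ge0// powR_ge0.
(* For [Q = 0] the scale [t] would vanish; in that case every term [w i * x i] is already zero. *)
move: Q0; rewrite le_eqVlt => /predU1P[Q0|Q0].
  rewrite esum1 ?lee_fin ?mulr_ge0 ?powR_ge0 ?(ltW K0)// => i _; congr EFin.
  have : (w i * x i `^ r)%:E = 0%E.
    apply/eqP; rewrite eq_le; apply/andP; split; last by rewrite lee_fin.
    apply: le_trans (le_term_esum (a := fun i => (w i * x i `^ r)%:E) i _) _.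
      by move=> j; rewrite lee_fin.
    by apply: le_trans hQ _; rewrite -Q0.
  move=> [/eqP]; rewrite mulf_eq0 => /orP[/eqP ->|/eqP/powR_eq0_eq0 ->].
    by rewrite mul0r.
  by rewrite mulr0.
pose t := (Q / K) `^ r^-1.
have QK : 0 < Q / K by rewrite divr_gt0.
have t0 : 0 < t by rewrite powR_gt0.
have tr : t `^ r = Q / K by rewrite /t -powRrM mulVf ?gt_eqF// powRr1// ltW.
have pw i : w i * x i <= (t * (K / Q) / r) * (w i * x i `^ r) + (t * (1 - r^-1)) * w i.
  have xt : (x i / t) `^ r = x i `^ r * (K / Q).
    have xt0 : 0 <= x i / t by rewrite divr_ge0// ltW.
    have h := powRM r xt0 (ltW t0).
    rewrite divfK ?gt_eqF// tr in h; rewrite h; field.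
    by rewrite !gt_eqF.
  have := @powR_tangent r (x i / t) r1; rewrite divr_ge0 ?(ltW t0)// => /(_ isT).
  rewrite xt ler_pdivrMr// => h.
  apply: le_trans (ler_wpM2l (w0 i) h) _.
  by rewrite le_eqVlt; apply/orP; left; apply/eqP; ring.
have c1 : 0 <= t * (K / Q) / r.
  by rewrite !mulr_ge0 ?invr_ge0 ?(ltW t0) ?(ltW K0) ?(ltW Q0) ?(ltW r0).
have c2 : 0 <= t * (1 - r^-1).
  by rewrite mulr_ge0 ?(ltW t0)// subr_ge0 invf_le1.
apply: (@le_trans _ _ (\esum_(i in setT) ((t * (K / Q) / r)%:E * (w i * x i `^ r)%:E
   + (t * (1 - r^-1))%:E * (w i)%:E))%E).
  by apply: le_esum => i _; rewrite -!EFinM -EFinD lee_fin.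
rewrite esumD; last 2 first.
- by move=> i _; rewrite -EFinM lee_fin mulr_ge0.
- by move=> i _; rewrite -EFinM lee_fin mulr_ge0.
rewrite !esumZl//; try by move=> i; rewrite lee_fin.
apply: (@le_trans _ _ ((t * (K / Q) / r)%:E * Q%:E + (t * (1 - r^-1))%:E * K%:E)%E).
  by apply: leeD; apply: lee_wpmul2l; rewrite ?lee_fin.
rewrite -!EFinM -EFinD lee_fin -/t le_eqVlt; apply/orP; left; apply/eqP.
by field; rewrite !gt_eqF.
Qed.

End WeightedPowerMean.

(** * Matrices with bounded row and column sums *)

Section Schur.
Variables (R : realType) (I : choiceType).
Implicit Types (M N : I -> I -> R[i]) (c : I -> R[i]) (p : \bar R).

(** A common constant for rows and columns bounds the operator on every l_p and makes the condition
    invariant under transposition. *)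
Definition schur K M :=
  (forall j, \esum_(k in setT) (normc (M j k))%:E <= K%:E)%E /\
  (forall k, \esum_(j in setT) (normc (M j k))%:E <= K%:E)%E.

(** Bounding the absolute sums, and not only [mx_op], gives summability of the rows and the Fubini
    hypothesis of [mx_opA] as well. *)
Definition absm M c (j : I) : \bar R :=
  (\esum_(k in setT) (normc (M j k * c k))%:E)%E.

Lemma absm_ge0 M c j : (0 <= absm M c j)%E.
Proof. by apply: esum_ge0 => k _; rewrite lee_fin normc_ge0. Qed.

Lemma lp_norm_le p c c' : (1 <= p)%E -> (forall k, normc (c k) <= normc (c' k)) ->
  (lp_norm p c <= lp_norm p c')%E.
Proof.
case: p => [r| |] //= r1 h.
  have r0 : 0 <= r by rewrite (le_trans ler01).
  apply: gt0_ler_poweR; rewrite ?invr_ge0// ?in_itv/= ?leey ?andbT.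
  - by apply: esum_ge0 => k _; rewrite lee_fin powR_ge0.
  - by apply: esum_ge0 => k _; rewrite lee_fin powR_ge0.
  apply: le_esum => k _; rewrite lee_fin.
  by apply: ge0_ler_powR; rewrite ?nnegrE ?normc_ge0.
apply: ge_ereal_sup => _ [k _ <-]; apply: (@le_trans _ _ (normc (c' k))%:E).
  by rewrite lee_fin.
by apply: ereal_sup_ubound; exists k.
Qed.

(** For finite [r], the power mean with the weights [|M j k|] of row [j] bounds the r-th power of
    [absm M c j] by [K ^ (r - 1) * Q j]; the column bound then controls the sum of the [Q j]. For p
    = oo the rows suffice. *)
Lemma schur_lp p K M c : (1 <= p)%E -> 0 < K -> schur K M -> lp p c ->
  (forall j, absm M c j < +oo)%E /\
  (lp_norm p (fun j => (fine (absm M c j))%:C) <= K%:E * lp_norm p c)%E.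
Proof.
case: p => [r| |] //.
- rewrite lee_fin => r1 K0 [M1 M2]; have r0 : 0 < r by exact: lt_le_trans r1.
  pose L := \esum_(k in setT) (normc (c k) `^ r)%:E.
  have L0 : (0 <= L)%E by apply: esum_ge0 => k _; rewrite lee_fin powR_ge0.
  rewrite /lp /= -/L => /lty_poweRy; rewrite invr_eq0 gt_eqF// => /(_ isT) Loo.
  pose Q j := \esum_(k in setT) (normc (M j k) * normc (c k) `^ r)%:E.
  have Q0 j : (0 <= Q j)%E.
    by apply: esum_ge0 => k _; rewrite lee_fin mulr_ge0 ?normc_ge0 ?powR_ge0.
  have QL : (\esum_(j in setT) Q j <= K%:E * L)%E.
    rewrite esum_swap => [|j k]; last by rewrite lee_fin mulr_ge0 ?normc_ge0 ?powR_ge0.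
    rewrite -esumZl ?(ltW K0)// => [|k]; last by rewrite lee_fin powR_ge0.
    apply: le_esum => k _; rewrite muleC.
    under eq_esum do rewrite mulrC EFinM.
    rewrite esumZl ?powR_ge0// => [|j]; last by rewrite lee_fin normc_ge0.
    by apply: lee_wpmul2l; rewrite ?lee_fin ?powR_ge0.
  have Qfin j : Q j \is a fin_num.
    have : (\esum_(j in setT) Q j < +oo)%E.
      by apply: le_lt_trans QL _; rewrite lte_mul_pinfty// lee_fin ltW.
    by move=> /esum_fin; apply.
  have hj j : (absm M c j <= (K * (fine (Q j) / K) `^ r^-1)%:E)%E.
    have := @weighted_esum_le R I r K (fine (Q j)) (fun k => normc (M j k))
      (fun k => normc (c k)) r1 K0.
    rewrite fine_ge0// => /(_ isT (fun k => normc_ge0 _) (fun k => normc_ge0 _)).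
    rewrite fineK// => /(_ (M1 j) (lexx _)).
    by under [X in (X <= _)%E -> _]eq_esum do rewrite -Normc.normcM.
  have afin j : (absm M c j < +oo)%E by apply: le_lt_trans (hj j) (ltry _).
  split=> //.
  have afn j : absm M c j \is a fin_num by rewrite ge0_fin_numE ?absm_ge0.
  have pw j : (fine (absm M c j)) `^ r <= K `^ r / K * fine (Q j).
    have hj' : fine (absm M c j) <= K * (fine (Q j) / K) `^ r^-1.
      by rewrite -lee_fin fineK.
    have qk : 0 <= fine (Q j) / K by rewrite divr_ge0 ?fine_ge0// ltW.
    apply: (@le_trans _ _ ((K * (fine (Q j) / K) `^ r^-1) `^ r)).
      apply: ge0_ler_powR; rewrite ?nnegrE ?fine_ge0 ?absm_ge0 ?(ltW r0)//.
      by rewrite mulr_ge0 ?powR_ge0 ?(ltW K0).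
    rewrite powRM ?powR_ge0 ?(ltW K0)// -powRrM mulVf ?gt_eqF// powRr1//.
    by rewrite mulrA mulrAC.
  have -> : (K%:E * L `^ r^-1 = (K `^ r)%:E `^ r^-1 * L `^ r^-1)%E.
    by rewrite poweR_EFin -powRrM mulfV ?gt_eqF// powRr1// ltW.
  rewrite -poweRM ?lee_fin ?powR_ge0//.
  apply: gt0_ler_poweR; rewrite ?invr_ge0 ?(ltW r0)// ?in_itv/= ?leey ?andbT.
  + by apply: esum_ge0 => j _; rewrite lee_fin powR_ge0.
  + by rewrite mule_ge0// lee_fin powR_ge0.
  apply: (@le_trans _ _ ((K `^ r / K)%:E * \esum_(j in setT) Q j)%E).
    have KK : 0 <= K `^ r / K by rewrite divr_ge0 ?powR_ge0// ltW.
    rewrite -esumZl//; apply: le_esum => j _; rewrite -[Q j]fineK// -EFinM lee_fin.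
    by rewrite expr0n /= addr0 sqrtr_sqr ger0_norm ?fine_ge0 ?absm_ge0.
  rewrite EFinM -muleA.
  apply: lee_wpmul2l; first by rewrite lee_fin powR_ge0.
  apply: le_trans (lee_wpmul2l _ QL) _; first by rewrite lee_fin invr_ge0 ltW.
  by rewrite muleA -EFinM mulVf ?gt_eqF// mul1e.
- move=> _ K0 [M1 M2]; rewrite /lp /=.
  set s := ereal_sup _ => soo.
  have cs k : ((normc (c k))%:E <= s)%E by apply: ereal_sup_ubound; exists k.
  have hj j : (absm M c j <= K%:E * s)%E.
    have s0 : (0 <= s)%E by apply: le_trans (cs j); rewrite lee_fin normc_ge0.
    have sfin : s \is a fin_num by rewrite ge0_fin_numE.
    apply: (@le_trans _ _ (\esum_(k in setT) (s * (normc (M j k))%:E))%E).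
      apply: le_esum => k _; rewrite Normc.normcM EFinM muleC.
      by apply: lee_wpmul2r; rewrite ?lee_fin ?normc_ge0.
    rewrite -[s]fineK// esumZl ?fine_ge0// => [|k]; last by rewrite lee_fin normc_ge0.
    by rewrite muleC; apply: lee_wpmul2r; rewrite ?lee_fin ?fine_ge0.
  have Ksoo (j : I) : (K%:E * s < +oo)%E.
    by apply: lte_mul_pinfty => //; rewrite lee_fin ltW.
  have afin j : (absm M c j < +oo)%E by apply: le_lt_trans (hj j) (Ksoo j).
  split=> //; apply: ge_ereal_sup => _ [j _ <-].
  rewrite expr0n /= addr0 sqrtr_sqr ger0_norm ?fine_ge0 ?absm_ge0//.
  by rewrite fineK// ge0_fin_numE ?absm_ge0.
Qed.

Lemma csummable_absm M c j : (absm M c j < +oo)%E ->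
  csummable setT (fun k => M j k * c k).
Proof. by move=> h; apply/csummableE. Qed.

Lemma normc_mx_op M c j : (absm M c j < +oo)%E ->
  normc (mx_op M c j) <= normc (fine (absm M c j))%:C.
Proof.
move=> h; rewrite normcR ger0_norm ?fine_ge0 ?absm_ge0// -lee_fin fineK.
  exact: csum_norm.
by rewrite ge0_fin_numE ?absm_ge0.
Qed.

Lemma schur_bounded p K M : (1 <= p)%E -> 0 < K -> schur K M -> bounded_mx p M.
Proof.
move=> p1 K0 MK; split.
  by move=> c j hc; apply: csummable_absm; have [+ _] := schur_lp p1 K0 MK hc; exact.
have bnd c : lp p c -> (lp_norm p (mx_op M c) <= K%:E * lp_norm p c)%E.
  move=> hc; have [h1 h2] := schur_lp p1 K0 MK hc.
  by apply: le_trans h2; apply: lp_norm_le => // j; exact: normc_mx_op.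
split.
- move=> x c c' hc hc'; apply/funext => j.
  have [h _] := schur_lp p1 K0 MK hc; have [h' _] := schur_lp p1 K0 MK hc'.
  rewrite /mx_op -csumZ//; last exact: h.
  rewrite -csumD; last 2 first.
  + by apply: l1Z_fin; exact: h.
  + exact: h'.
  by congr csum; apply/funext => k; ring.
- move=> c hc; rewrite /lp /=; apply: le_lt_trans (bnd c hc) _.
  (* The norm can be negative: over an empty index set the supremum for p = oo is [-oo]. *)
  have [n0|n0] := leP 0%E (lp_norm p c).
    by apply: lte_mul_pinfty => //; rewrite lee_fin ltW.
  apply: (@le_lt_trans _ _ 0%E) => //.
  by apply: mule_ge0_le0; [rewrite lee_fin ltW|exact: ltW].
- by exists K.
Qed.

Lemma schur_tr K M : schur K M -> schur K (mx_tr M).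
Proof. by move=> []. Qed.

Lemma schur_prod_esum K K' M N j : schur K M -> schur K' N -> 0 < K' ->
  (\esum_(l in setT) \esum_(k in setT) (normc (M j k * N k l))%:E <= (K * K')%:E)%E.
Proof.
move=> [M1 M2] [N1 N2] K0; rewrite esum_swap => [|l k]; last by rewrite lee_fin normc_ge0.
apply: (@le_trans _ _ (\esum_(k in setT) (K'%:E * (normc (M j k))%:E))%E).
  apply: le_esum => k _; under eq_esum do rewrite Normc.normcM EFinM.
  rewrite esumZl ?normc_ge0// => [|l]; last by rewrite lee_fin normc_ge0.
  by rewrite muleC; apply: lee_wpmul2r; rewrite ?lee_fin ?normc_ge0.
rewrite esumZl ?(ltW K0)// => [|k]; last by rewrite lee_fin normc_ge0.
by rewrite mulrC EFinM; apply: lee_wpmul2l; rewrite ?lee_fin ?(ltW K0).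
Qed.

Lemma schur_prod_summable K K' M N j l : schur K M -> schur K' N -> 0 < K' ->
  (l1 (fun k => M j k * N k l)%R < +oo)%E.
Proof.
move=> MK NK K0; apply: le_lt_trans (ltry (K * K')).
apply: le_trans (schur_prod_esum j MK NK K0).
apply: (@le_term_esum _ _ (fun l => l1 (fun k => M j k * N k l))) => i.
exact: l1_ge0.
Qed.

Lemma schur_prod K K' M N : schur K M -> schur K' N -> 0 < K -> 0 < K' ->
  schur (K * K') (mx_prod M N).
Proof.
move=> MK NK K0 K'0; split=> [j|l].
  apply: le_trans (schur_prod_esum j MK NK K'0); apply: le_esum => l _.
  exact: csum_norm.
rewrite mulrC; apply: le_trans (schur_prod_esum l (schur_tr NK) (schur_tr MK) K0).
apply: le_esum => j _; apply: le_trans (csum_norm _) _.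
by apply: le_esum => k _; rewrite /mx_tr mulrC.
Qed.

(** The vector of absolute row sums [absm N c] is itself in l_p, so Schur's test for [M] applied to
    it gives the double summability needed to exchange the sums. *)
Lemma mx_opA p K K' M N c : (1 <= p)%E -> schur K M -> schur K' N -> 0 < K ->
  0 < K' -> lp p c -> mx_op (mx_prod M N) c = mx_op M (mx_op N c).
Proof.
move=> p1 MK NK K0 K'0 hc; apply/funext => j; rewrite /mx_op.
have [h1 h2] := schur_lp p1 K'0 NK hc.
have hc' : lp p (fun k => (fine (absm N c k))%:C).
  rewrite /lp /=; apply: le_lt_trans h2 _.
  have [n0|n0] := leP 0%E (lp_norm p c).
    by apply: lte_mul_pinfty => //; rewrite lee_fin ltW.
  apply: (@le_lt_trans _ _ 0%E) => //.
  by apply: mule_ge0_le0; [rewrite lee_fin ltW|exact: ltW].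
have [g1 _] := schur_lp p1 K0 MK hc'.
have fin : (\esum_(k in setT) \esum_(l in setT) (normc (M j k * (N k l * c l)))%:E < +oo)%E.
  apply: le_lt_trans (g1 j); apply: le_esum => k _.
  rewrite -[leLHS]/(l1 (fun l => M j k * (N k l * c l))) l1Z.
  rewrite Normc.normcM normcR ger0_norm ?fine_ge0 ?absm_ge0// EFinM fineK//.
  by rewrite ge0_fin_numE ?absm_ge0.
transitivity (csum setT (fun k => csum setT (fun l => M j k * (N k l * c l)))); last first.
  by congr csum; apply/funext => k; rewrite csumZ//; exact: h1.
rewrite (csum_swap fin); congr csum; apply/funext => l.
rewrite mulrC -csumZ; last exact: schur_prod_summable MK NK K'0.
by congr csum; apply/funext => k; ring.
Qed.

Definition mx_id (j k : I) : R[i] := if k == j then 1 else 0.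

Lemma mx_op_id c : mx_op mx_id c = c.
Proof.
apply/funext => j; rewrite /mx_op (csum_delta (i := j)) /mx_id ?eqxx ?mul1r//.
by move=> k /negPf ->; rewrite mul0r.
Qed.

Lemma schur_inverse p K K' M N : (1 <= p)%E -> schur K M -> schur K' N -> 0 < K ->
  0 < K' -> mx_prod M N = mx_id -> mx_prod N M = mx_id ->
  inverse_op p (mx_op M) (mx_op N).
Proof.
move=> p1 MK NK K0 K'0 MN NM; split; first by have [] := schur_bounded p1 K'0 NK.
move=> c hc; split.
  by rewrite -(mx_opA p1 NK MK)// NM mx_op_id.
by rewrite -(mx_opA p1 MK NK)// MN mx_op_id.
Qed.

End Schur.


(** * Uniqueness of coefficients, reflection and the unit *)

Section SymbolInjectivity.
Variables (R : realType) (d : nat).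
Implicit Types a b : lattice d -> R[i].

(** Both families are the Fourier coefficients of one function [u], defined on all vectors but
    evaluated only at torus points. *)
Lemma symb_inj a b : (l1 a < +oo)%E -> (l1 b < +oo)%E ->
  (forall t : 'rV[R]_d, symb a t = symb b t) -> a = b.
Proof.
move=> ha hb ab; pose u (z : 'rV[R[i]]_d) := csum setT (fun k => a k * monom k z).
have uE t : u (torus_point t) = symb a t.
  by congr csum; apply/funext => k; rewrite monomE.
apply/funext => k; rewrite -(fourier_symb ha uE k).
by apply: (fourier_symb hb) => t; rewrite uE.
Qed.

Definition mirror a (k : lattice d) := a (- k).

Lemma bij_opp : bijective (fun k : lattice d => - k).
Proof. by exists (fun k => - k) => k; rewrite opprK. Qed.

Lemma l1_mirror a : l1 (mirror a) = l1 a.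
Proof. by rewrite [RHS](l1_bij _ bij_opp). Qed.

Lemma symb_mirror a t : symb (mirror a) t = symb a (- t).
Proof.
rewrite /symb (csum_bij _ bij_opp); congr csum; apply/funext => k /=.
by rewrite /mirror opprK chiN.
Qed.

Definition delta0 (k : lattice d) : R[i] := if k == 0 then 1 else 0.

Lemma symb_delta0 t : symb delta0 t = 1.
Proof.
rewrite /symb (csum_delta (i := 0)) /delta0 ?eqxx ?chi0 ?mulr1//.
by move=> k /negPf ->; rewrite mul0r.
Qed.

Lemma l1_delta0 : (l1 delta0 < +oo)%E.
Proof.
have := l1_finsupp [:: (0 : lattice d)] (fun=> 1 : R[i]).
by under eq_fun do rewrite inE.
Qed.

Lemma convol_fin a b : (l1 a < +oo)%E -> (l1 b < +oo)%E -> (l1 (convol a b) < +oo)%E.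
Proof.
move=> ha hb; apply: le_lt_trans (l1_convol (l1_fin_le ha) (l1_fin_le hb)) _.
exact: ltry.
Qed.

Lemma convol_delta0 a b : (l1 a < +oo)%E -> (l1 b < +oo)%E ->
  (forall t : 'rV[R]_d, symb a t * symb b t = 1) -> convol a b = delta0.
Proof.
move=> ha hb ab; apply: symb_inj; [exact: convol_fin|exact: l1_delta0|].
by move=> t; rewrite symb_convol// ab symb_delta0.
Qed.

End SymbolInjectivity.

(** * Toeplitz operators on a half-lattice *)

Section HalfLattice.
Variables (n : nat) (H : half_lattice n).

(** With [in_halfD] this makes the half-lattice a monoid. The two kinds of [H] are told apart again
    only for [half_weight] and [Lambda_plus]. *)
Lemma in_half0 : in_half H 0.
Proof.
by case: H => [|le] /=; [rewrite mxE|have := lo_total le 0 0; rewrite orbb].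
Qed.

Lemma in_halfD k l : in_half H k -> in_half H l -> in_half H (k + l).
Proof.
case: H => [|le] /=; first by rewrite mxE; exact: addr_ge0.
move=> hk hl; apply: (lo_trans hl).
by have := lo_add l hk; rewrite add0r.
Qed.

End HalfLattice.

Section HalfToeplitz.
Variables (R : realType) (n : nat) (H : half_lattice n).
Implicit Types a b : lattice n.+1 -> R[i].

Lemma val_half_bij :
  set_bij setT [set k | in_half H k] (val : half_index H -> lattice n.+1).
Proof.
split=> [k _|k l _ _|k hk] /=; [exact: (valP k)|exact: val_inj|].
by exists (exist _ k hk).
Qed.

Lemma csum_half (F : lattice n.+1 -> R[i]) :
  csum setT (fun k : half_index H => F (val k)) =
  csum setT (fun k => if in_half H k then F k else 0).
Proof.
rewrite -(csum_reindex F val_half_bij) csum_mkcond; congr csum; apply/funext => k.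
by have -> : (k \in [set k | in_half H k]) = in_half H k by apply/idP/idP; rewrite inE.
Qed.

Lemma esum_half_le (F : lattice n.+1 -> \bar R) : (forall k, 0 <= F k)%E ->
  (\esum_(k in [set: half_index H]) F (val k) <= \esum_(k in setT) F k)%E.
Proof.
move=> F0; rewrite -(reindex_esum _ _ _ F val_half_bij) esum_mkcond.
by apply: le_esum => k _; case: ifP.
Qed.

Definition Tz a (j k : half_index H) : R[i] := a (val j - val k).

(** Each row and column lists values of [a] at distinct points. Adding 1 keeps the constant positive
    even for [a = 0]. *)
Lemma schur_Tz a : (l1 a < +oo)%E -> schur (fine (l1 a) + 1) (Tz a).
Proof.
move=> ha; have hK : (l1 a <= (fine (l1 a) + 1)%:E)%E.
  by rewrite EFinD fineK ?ge0_fin_numE ?l1_ge0// leeDl.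
have nn x : (0 <= (normc (a x))%:E)%E by rewrite lee_fin normc_ge0.
split=> [j|k]; apply: le_trans hK.
  have bj : bijective (fun l : lattice n.+1 => val j - l).
    by exists (fun l => val j - l) => l; rewrite opprB addrC subrK.
  rewrite (l1_bij a bj).
  exact: (@esum_half_le (fun l => (normc (a (val j - l)))%:E)).
rewrite (l1_bij a (bij_translation (val k))).
exact: (@esum_half_le (fun l => (normc (a (l - val k)))%:E)).
Qed.

(* Either support condition makes the terms with [l] outside the half-lattice
   vanish, so that the sum over the half-lattice is a full convolution. *)
Lemma Tz_prod a b :
  (forall k, ~~ in_half H k -> b k = 0) \/ (forall k, ~~ in_half H (- k) -> a k = 0) ->
  mx_prod (Tz a) (Tz b) = Tz (convol a b).
Proof.
move=> hab; apply/funext => j; apply/funext => k; rewrite /mx_prod /Tz.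
rewrite (csum_half (fun l => a (val j - l) * b (l - val k))).
rewrite (csum_bij _ (_ : bijective (fun l => l + val k))); last first.
  by exists (fun l => l - val k) => l; rewrite ?addrK ?subrK.
congr csum; apply/funext => l /=; rewrite addrK opprD addrA addrAC.
case: ifPn => // lk; case: hab => [hb|ha].
  rewrite hb ?mulr0//; apply: contra lk => hl.
  by apply: in_halfD => //; exact: (valP k).
rewrite ha ?mul0r//; apply: contra lk => hl.
by have := in_halfD hl (valP j); rewrite !opprB addrA subrK.
Qed.

Lemma Tz_delta0 : Tz (@delta0 R n.+1) = @mx_id R _.
Proof.
apply/funext => j; apply/funext => k; rewrite /Tz /delta0 /mx_id subr_eq0 eq_sym.
by rewrite (inj_eq val_inj).
Qed.

Lemma mx_tr_Tz a : mx_tr (Tz a) = Tz (mirror a).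
Proof. by apply/funext => j; apply/funext => k; rewrite /mx_tr /Tz /mirror opprB. Qed.

End HalfToeplitz.


(** * Wiener-Hopf factorization *)

Section CardinalSymbol.
Variables (R : realType) (n : nat) (phi : 'rV[R]_n.+1 -> R).
Hypothesis phi_symmetric : forall x, phi (- x) = phi x.
Hypothesis phi_finite : (amalgam_norm phi < +oo)%E.
Hypothesis symbol_pos : forall z, torus z -> 0 < cardinal_symbol phi z.

Definition samples (k : lattice n.+1) : R[i] := (phi (lattice_pt R k))%:C.

Lemma lattice_ptN k : lattice_pt R (- k) = - lattice_pt R k :> 'rV[R]_n.+1.
Proof. by apply/rowP => i; rewrite !mxE rmorphN. Qed.

Lemma l1_samples : (l1 samples < +oo)%E.
Proof.
apply: le_lt_trans phi_finite.
(* The supremum in [amalgam_norm] is used at the point 0. *)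
apply: (@le_trans _ _ (\esum_(k in setT) `|phi (0 - lattice_pt R k)|%:E)%E).
  by apply: le_esum => k _; rewrite sub0r phi_symmetric normcR.
apply: ereal_sup_ubound; exists 0 => //= i.
by rewrite mxE lexx ler01.
Qed.

Lemma mirror_samples : mirror samples = samples.
Proof. by apply/funext => k; rewrite /mirror /samples lattice_ptN phi_symmetric. Qed.

Lemma cardinal_symbolE t : cardinal_symbol phi (torus_point t) = symb samples t.
Proof. by congr csum; apply/funext => k; rewrite monomE. Qed.

Lemma symb_samples_gt0 t : 0 < symb samples t.
Proof. by rewrite -cardinal_symbolE; apply: symbol_pos; exact: torus_torus_point. Qed.

Definition symbR t : R := complex.Re (symb samples t).

Lemma symbRE t : symb samples t = (symbR t)%:C.
Proof.
have := symb_samples_gt0 t; rewrite ltcE /symbR.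
by case: (symb samples t) => x y /= /andP[/eqP -> _].
Qed.

Lemma symbR_gt0 t : 0 < symbR t.
Proof. by have := symb_samples_gt0 t; rewrite symbRE ltcR. Qed.

Lemma omegaE t : omega phi (torus_point t) = ((symbR t)^-1)%:C.
Proof. by rewrite /omega cardinal_symbolE symbRE rmorphV ?unitfE ?gt_eqF ?symbR_gt0. Qed.

Lemma log_omegaE t : log_omega phi (torus_point t) = (- ln (symbR t))%:C.
Proof. by rewrite /log_omega omegaE lnV// posrE symbR_gt0. Qed.

Lemma lambda_summable : (l1 (lambda phi) < +oo)%E /\
  forall t, log_omega phi (torus_point t) = symb (lambda phi) t.
Proof.
have [B hB] := wiener_log l1_samples symb_samples_gt0.
have [a [_ ha au]] := wien_fin (wienZ (-1) hB).
have E t : log_omega phi (torus_point t) = symb a t.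
  by rewrite -au log_omegaE mulN1r rmorphN.
suff -> : lambda phi = a by [].
by apply/funext => k; exact: fourier_symb.
Qed.

(** Symmetry of [phi] makes the cardinal symbol even in [t], hence its logarithm too. *)
Lemma mirror_lambda : mirror (lambda phi) = lambda phi.
Proof.
have [h E] := lambda_summable.
apply: symb_inj; [by rewrite l1_mirror|exact: h|] => t.
rewrite symb_mirror -(E (- t)) -(E t) (log_omegaE (- t)) (log_omegaE t).
by rewrite /symbR -symb_mirror mirror_samples.
Qed.

Variable H : half_lattice n.

(** Turns both shapes of [Lambda_plus] into one multiplier on [lambda]; the value 1/2 falls where
    [k] and [- k] both lie in the half-lattice. *)
Definition half_weight (k : lattice n.+1) : R[i] :=
  match H with
  | CoordHalf => if k 0 ord_max == 0 then 2^-1 else if 0 < k 0 ord_max then 1 else 0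
  | OrderHalf le => if k == 0 then 2^-1 else if le 0 k then 1 else 0
  end.

Lemma half_weightD k : half_weight k + half_weight (- k) = 1.
Proof.
have nz : 2 != 0 :> R[i] by rewrite pnatr_eq0.
have half2 : 2^-1 + 2^-1 = 1 :> R[i] by apply: (mulfI nz); rewrite mulrDr mulfV// mulr1.
rewrite /half_weight; case: H => [|le].
  rewrite !mxE oppr_eq0 oppr_gt0; case: ltgtP => _; rewrite ?addr0 ?add0r//.
rewrite oppr_eq0; case: eqP => // /eqP k0.
(* By totality and antisymmetry, exactly one of [k] and [- k] is positive when [k] is nonzero. *)
have -> : le 0 (- k) = ~~ le 0 k; last by case: (le 0 k); rewrite ?addr0 ?add0r.
have kN : le 0 (- k) = le k 0.
  apply/idP/idP => h; first by have := lo_add k h; rewrite add0r addNr.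
  by have := lo_add (- k) h; rewrite subrr add0r.
rewrite kN; apply/idP/idP => h.
  by apply/negP => h'; move/eqP: k0; apply; apply: (@lo_anti _ le); rewrite h h'.
by have := lo_total le 0 k; rewrite (negPf h).
Qed.

Lemma half_weight_supp k : ~~ in_half H k -> half_weight k = 0.
Proof.
rewrite /half_weight; case: H => [|le] /=.
  by rewrite -ltNge => k0; rewrite lt_eqF// ltNge ltW.
move=> /negPf kle; rewrite kle; case: eqP => // k0.
by have := lo_total le 0 0; rewrite -{2 4}k0 kle.
Qed.

Lemma normc_half_weight k : normc (half_weight k) <= 1.
Proof.
have h1 : normc (2^-1 : R[i]) <= 1.
  have -> : (2^-1 : R[i]) = (2^-1 : R)%:C by rewrite fmorphV rmorph_nat.
  by rewrite normcR ger0_norm ?invr_ge0// invf_le1// ler1n.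
rewrite /half_weight; case: H => [|le]; do 2?case: ifP => _;
  by rewrite ?Normc.normc1 ?Normc.normc0 ?ler01 ?lexx.
Qed.

Definition Lcoef k : R[i] := half_weight k * lambda phi k.

Lemma l1_Lcoef : (l1 Lcoef < +oo)%E.
Proof.
have [h _] := lambda_summable; apply: l1_le_fin h => k.
by rewrite Normc.normcM ler_piMl ?normc_ge0 ?normc_half_weight.
Qed.

Lemma Lambda_plusE t : Lambda_plus phi H (torus_point t) = symb Lcoef t.
Proof.
have [hl _] := lambda_summable.
have hw (w : lattice n.+1 -> R[i]) : (forall k, normc (w k) <= 1) ->
    (l1 (fun k => w k * (lambda phi k * chi k t))%R < +oo)%E.
  move=> w1; apply: l1_le_fin hl => k; rewrite !Normc.normcM normc_chi mulr1.
  by rewrite ler_piMl ?normc_ge0.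
have ind1 (b : bool) : normc (if b then 1 else 0 : R[i]) <= 1.
  by case: b; rewrite ?Normc.normc1 ?Normc.normc0.
have csum_ind (P : pred (lattice n.+1)) :
    csum [set k | P k] (fun k => lambda phi k * monom k (torus_point t)) =
    csum setT (fun k => (if P k then 1 else 0) * (lambda phi k * chi k t)).
  rewrite csum_mkcond; congr csum; apply/funext => k; rewrite monomE.
  have -> : (k \in [set k | P k]) = P k by apply/idP/idP; rewrite inE.
  by case: ifP; rewrite ?mul1r ?mul0r.
rewrite /Lambda_plus /symb /Lcoef /half_weight; case: H => [|le].
  have -> : [set k : lattice n.+1 | k 0 ord_max = 0] = [set k | k 0 ord_max == 0].
    by apply/seteqP; split => k /= /eqP.
  rewrite (csum_ind (fun k => k 0 ord_max == 0)) (csum_ind (fun k => 0 < k 0 ord_max)).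
  have h0 := hw (fun k => if k 0 ord_max == 0 then 1 else 0) (fun k => ind1 _).
  have h1 := hw (fun k => if 0 < k 0 ord_max then 1 else 0) (fun k => ind1 _).
  rewrite -(csumZ 2^-1 h0) -(csumD (l1Z_fin 2^-1 h0) h1).
  congr csum; apply/funext => k; case: eqP => [->|_].
    by rewrite ltxx mul0r addr0 mul1r mulrA.
  by rewrite mul0r mulr0 add0r mulrA.
rewrite (csum_ind (fun k => le 0 k && (k != 0))).
have -> : 2^-1 * lambda phi 0 = 2^-1 *
    csum setT (fun k => (if k == 0 then 1 else 0) * (lambda phi k * chi k t)).
  rewrite (csum_delta (i := 0)) ?eqxx ?mul1r ?chi0 ?mulr1// => k /negPf ->.
  by rewrite mul0r.
have h0 := hw (fun k => if k == 0 then 1 else 0) (fun k => ind1 _).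
have h1 := hw (fun k => if le 0 k && (k != 0) then 1 else 0) (fun k => ind1 _).
rewrite -(csumZ 2^-1 h0) -(csumD (l1Z_fin 2^-1 h0) h1).
congr csum; apply/funext => k; rewrite andbC; case: eqP => [_|_] /=.
  by rewrite mul1r mul0r addr0 mulrA.
by rewrite mul0r mulr0 add0r mulrA.
Qed.

(** The Wiener-Hopf factorization in logarithmic form: [lambda] is even and the weights of [k] and
    [- k] add up to 1. *)
Lemma symb_LcoefD t : symb Lcoef t + symb Lcoef (- t) = (- ln (symbR t))%:C.
Proof.
have [hl E] := lambda_summable.
rewrite -symb_mirror -symbD ?l1_mirror ?l1_Lcoef// -log_omegaE E; congr (symb _ t).
apply/funext => k; rewrite /mirror /Lcoef.
have -> : lambda phi (- k) = lambda phi k by rewrite -[RHS](congr1 (@^~ k) mirror_lambda).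
by rewrite -mulrDl half_weightD mul1r.
Qed.

(* [g] and [h] are the coefficients of [omega_plus] and of its inverse. *)
Lemma wiener_hopf : exists g h : lattice n.+1 -> R[i],
  [/\ (l1 g < +oo)%E /\ (forall k, ~~ in_half H k -> g k = 0),
      (l1 h < +oo)%E /\ (forall k, ~~ in_half H k -> h k = 0),
      forall t, omega_plus phi H (torus_point t) = symb g t,
      forall t, symb g t * symb h t = 1 &
      forall t, symb h t * symb h (- t) = symb samples t].
Proof.
have [l0 lD] : [set k | in_half H k] 0 /\ (forall k l, [set k | in_half H k] k ->
    [set k | in_half H k] l -> [set k | in_half H k] (k + l)).
  by split; [exact: in_half0|exact: in_halfD].
have wL : wien [set k | in_half H k] (symb Lcoef) (fine (l1 Lcoef)).
  exists Lcoef; split=> // [k /negP kH|]; last exact/l1_fin_le/l1_Lcoef.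
  by rewrite /Lcoef half_weight_supp// mul0r.
have [g [gs gf gu]] := wien_fin (wien_cexp l0 lD wL).
have [h [hs hf hu]] := wien_fin (wien_cexp l0 lD (wienZ (-1) wL)).
exists g, h; split.
- by split=> // k /negP; exact: gs.
- by split=> // k /negP; exact: hs.
- by move=> t; rewrite /omega_plus Lambda_plusE gu.
- by move=> t; rewrite -gu -hu -cexpD mulN1r subrr cexp0.
- move=> t; rewrite -!hu -cexpD -mulrDr symb_LcoefD mulN1r rmorphN opprK symbRE.
  by rewrite /= cos0 sin0 mulr1 mulr0 lnK// posrE symbR_gt0.
Qed.

End CardinalSymbol.


(** * Coefficients of the semi-cardinal symbols *)

Section SemiCardinal.
Variables (R : realType) (n : nat) (phi : 'rV[R]_n.+1 -> R) (H : half_lattice n).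
Variable g : lattice n.+1 -> R[i].
Hypothesis l1_g : (l1 g < +oo)%E.
Hypothesis g_supp : forall k, ~~ in_half H k -> g k = 0.
Hypothesis omega_plusE : forall t, omega_plus phi H (torus_point t) = symb g t.

Lemma gammaE : gamma phi H = g.
Proof.
apply/funext => k; rewrite /gamma; case: ifPn => [_|/g_supp ->//].
exact: fourier_symb.
Qed.

Lemma G_mxE : G_mx phi (H := H) = Tz (H := H) g.
Proof. by apply/funext => j; apply/funext => k; rewrite /G_mx gammaE. Qed.

(** Reflecting and multiplying by the monomial of [j] turns [g] into [g (j - l)], [P_plus] cuts this
    to the half-lattice, and the factor [omega_plus] convolves with [g]. The cut becomes the inner
    summation range of [G G^T]. *)
Lemma semicardinal_fourier j k :
  fourier (semicardinal_symbol phi H j) k =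
  csum setT (fun l => g (k - l) * (if in_half H l then g (j - l) else 0)).
Proof.
pose gj l := g (j - l).
have bj : bijective (fun l : lattice n.+1 => j - l).
  by exists (fun l => j - l) => l; rewrite opprB addrC subrK.
have l1_gj : (l1 gj < +oo)%E by rewrite -(l1_bij g bj).
have psiE t : monom j (torus_point t) * omega_plus phi H (torus_inv (torus_point t)) =
    symb gj t.
  rewrite torus_invE omega_plusE monomE /symb [RHS](csum_bij _ bj) -csumZ; last first.
    by rewrite l1_Mchar// => l; exact: normc_chi.
  congr csum; apply/funext => l /=.
  rewrite /gj opprB addrC subrK chiD -chiN.
  by rewrite mulrCA.
pose b l := if in_half H l then gj l else 0.
have l1_b : (l1 b < +oo)%E.
  apply: l1_le_fin l1_gj => l; rewrite /b; case: ifP => // _.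
  by rewrite Normc.normc0 normc_ge0.
have PE t : P_plus H (fun w => monom j w * omega_plus phi H (torus_inv w))
    (torus_point t) = symb b t.
  rewrite /P_plus csum_mkcond; congr csum; apply/funext => l.
  have -> : (l \in [set k | in_half H k]) = in_half H l by apply/idP/idP; rewrite inE.
  rewrite (fourier_symb l1_gj psiE) monomE /b.
  by case: ifP => // _; rewrite mul0r.
apply: (fourier_symb (a := convol g b)); first exact: convol_fin.
by move=> t; rewrite /semicardinal_symbol PE omega_plusE symb_convol.
Qed.

Lemma a_mxE : a_mx phi (H := H) = mx_prod (Tz (H := H) g) (mx_tr (Tz (H := H) g)).
Proof.
apply/funext => k; apply/funext => j; rewrite /a_mx semicardinal_fourier.
rewrite [RHS](csum_half H (fun l => g (val k - l) * g (val j - l))).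
by congr csum; apply/funext => l; case: ifP; rewrite ?mulr0.
Qed.

End SemiCardinal.

(** * Inversion and factorization of the Toeplitz operator *)

Theorem corollary3p6 (R : realType) (n : nat) (phi : 'rV[R]_n.+1 -> R)
    (H : half_lattice n)
    (phi_continuous : continuous phi)
    (phi_symmetric : forall x, phi (- x) = phi x)
    (phi_finite : (amalgam_norm phi < +oo)%E)
    (symbol_pos : forall z, torus z -> 0 < cardinal_symbol phi z) :
  let T := toeplitz phi (H := H) in
  let G := G_mx phi (H := H) in
  let A := a_mx phi (H := H) in
  (forall k j, csummable setT (fun l => G k l * mx_tr G l j)) /\
  A = mx_prod G (mx_tr G) /\
  forall p : \bar R, (1 <= p)%E ->
    (bounded_mx p T /\ invertible_op p (mx_op T)) /\
    (bounded_mx p A /\ inverse_op p (mx_op T) (mx_op A)) /\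
    (bounded_mx p G /\ invertible_op p (mx_op G)) /\
    bounded_mx p (mx_tr G) /\
    (forall c, lp p c -> mx_op A c = mx_op G (mx_op (mx_tr G) c)).
Proof.
move=> T G A.
have [g [h [[g_fin g_supp] [h_fin h_supp] gE gh hh]]] :=
  wiener_hopf phi_symmetric phi_finite symbol_pos H.
have rg_fin : (l1 (mirror g) < +oo)%E by rewrite l1_mirror.
have rh_fin : (l1 (mirror h) < +oo)%E by rewrite l1_mirror.
have mirror_supp (a : lattice n.+1 -> R[i]) : (forall k, ~~ in_half H k -> a k = 0) ->
    forall k, ~~ in_half H (- k) -> mirror a k = 0.
  by move=> as0 k kH; exact: as0.
have GE : G = Tz (H := H) g by exact: G_mxE g_fin g_supp gE.
have GtE : mx_tr G = Tz (H := H) (mirror g) by rewrite GE mx_tr_Tz.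
have AE : A = mx_prod G (mx_tr G) by rewrite GE; exact: a_mxE g_fin gE.
(* Products of [g] and [h] use the support of the right factor, those of their mirrors the support
   of the left one. *)
have id_gh : mx_prod (Tz (H := H) g) (Tz h) = @mx_id R _.
  by rewrite Tz_prod ?(convol_delta0 g_fin h_fin gh) ?Tz_delta0//; left.
have id_hg : mx_prod (Tz (H := H) h) (Tz g) = @mx_id R _.
  rewrite Tz_prod ?(convol_delta0 h_fin g_fin) ?Tz_delta0//; last by left.
  by move=> t; rewrite mulrC.
have id_rgrh : mx_prod (Tz (H := H) (mirror g)) (Tz (mirror h)) = @mx_id R _.
  rewrite Tz_prod ?(convol_delta0 rg_fin rh_fin) ?Tz_delta0//.
    by move=> t; rewrite !symb_mirror.
  by right; exact: mirror_supp.
have id_rhrg : mx_prod (Tz (H := H) (mirror h)) (Tz (mirror g)) = @mx_id R _.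
  rewrite Tz_prod ?(convol_delta0 rh_fin rg_fin) ?Tz_delta0//.
    by move=> t; rewrite !symb_mirror mulrC.
  by right; exact: mirror_supp.
(* In this order both support conditions hold; the product of symbols is [samples], as [h] comes
   from [1 / omega_plus]. *)
have TE : T = mx_prod (Tz (H := H) (mirror h)) (Tz h).
  rewrite Tz_prod; last by left.
  have -> : convol (mirror h) h = samples phi.
    apply: symb_inj => [||t]; [exact: convol_fin|exact: l1_samples|].
    by rewrite symb_convol// symb_mirror mulrC hh.
  by [].
pose K (a : lattice n.+1 -> R[i]) : R := fine (l1 a) + 1.
have K0 (a : lattice n.+1 -> R[i]) : 0 < K a.
  by rewrite ltr_wpDl// fine_ge0// l1_ge0.
have Sg : schur (K g) (Tz (H := H) g) by exact: schur_Tz.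
have Sh : schur (K h) (Tz (H := H) h) by exact: schur_Tz.
have Srg : schur (K (mirror g)) (Tz (H := H) (mirror g)) by exact: schur_Tz.
have Srh : schur (K (mirror h)) (Tz (H := H) (mirror h)) by exact: schur_Tz.
have ST : schur (K (mirror h) * K h) T by rewrite TE; exact: schur_prod.
have SA : schur (K g * K (mirror g)) A.
  by rewrite AE GtE GE; exact: schur_prod.
have SG : schur (K g) G by rewrite GE.
split; [|split=> // p p1].
  by move=> k j; apply/csummableE; exact: (schur_prod_summable k j SG (schur_tr SG)).
have KT : 0 < K (mirror h) * K h by rewrite mulr_gt0.
have KA : 0 < K g * K (mirror g) by rewrite mulr_gt0.
have mxT c : lp p c -> mx_op T c = mx_op (Tz (mirror h)) (mx_op (Tz h) c).
  by rewrite TE; exact: mx_opA p1 Srh Sh (K0 _) (K0 _).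
have mxA c : lp p c -> mx_op A c = mx_op (Tz g) (mx_op (Tz (mirror g)) c).
  by rewrite AE GtE GE; exact: mx_opA p1 Sg Srg (K0 _) (K0 _).
have [inv_gh inv_rg] : inverse_op p (mx_op (Tz (H := H) g)) (mx_op (Tz h)) /\
    inverse_op p (mx_op (Tz (H := H) (mirror g))) (mx_op (Tz (mirror h))).
  split.
    exact: schur_inverse p1 Sg Sh (K0 _) (K0 _) id_gh id_hg.
  exact: schur_inverse p1 Srg Srh (K0 _) (K0 _) id_rgrh id_rhrg.
have lpT (a : lattice n.+1 -> R[i]) c : (l1 a < +oo)%E -> lp p c ->
    lp p (mx_op (Tz (H := H) a) c).
  move=> ha; have [_ [_ + _]] := schur_bounded p1 (K0 a) (schur_Tz H ha).
  exact.
(* The four-fold products cancel from the inside out; [lpT] keeps the intermediate vectors in l_p,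
   where the inverse relations hold. *)
have invTA : inverse_op p (mx_op T) (mx_op A).
  have [_ bA] := schur_bounded p1 KA SA; split=> // c hc; split.
    rewrite mxT// mxA; last exact/lpT/lpT.
    have [_ /(_ _ (lpT _ _ h_fin hc))[_ ->]] := inv_rg.
    by have [_ /(_ _ hc)[_ ->]] := inv_gh.
  rewrite mxA// mxT; last exact/lpT/lpT.
  have [_ /(_ _ (lpT _ _ rg_fin hc))[-> _]] := inv_gh.
  by have [_ /(_ _ hc)[-> _]] := inv_rg.
split; first by split; [exact: schur_bounded p1 KT ST|exists (mx_op A)].
split; first by split=> //; exact: schur_bounded p1 KA SA.
split.
  split; first exact: schur_bounded p1 (K0 g) SG.
  by rewrite GE; exists (mx_op (Tz h)).
split; first exact: schur_bounded p1 (K0 g) (schur_tr SG).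
by move=> c hc; rewrite mxA// GtE GE.
Qed.
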